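(* Let $1\le p<2$ and let $\{X_{m,n},\, m\ge 1,\, n\ge 1\}$ be a double array of random variables satisfying Condition $(H_2)$. For $n\ge1$, $i\ge1$, $j\ge1$, set $b_n=n^{1/p}$ and $Z_{n,i,j}=X_{i,j}\mathbf{1}(|X_{i,j}|\le b_n)$. (Sufficiency) If $\{X_{m,n},\, m\ge 1,\, n\ge 1\}$ is stochastically dominated by a random variable $X$ satisfying $$n\,\mathbb{P}(|X|>n^{1/p})\to 0\quad\text{as }n\to\infty, \qquad (1)$$ then $$\frac{\max_{1\le u\le m,\,1\le v\le n}\left|\sum_{i=1}^{u}\sum_{j=1}^{v}(X_{i,j}-\mathbb{E}Z_{mn,i,j})\right|}{(mn)^{1/p}}\to 0\ \text{ in probability as }\ m\vee n\to\infty. \qquad (2)$$ (Necessity) Conversely, if the random variables $X_{m,n}$, $m\ge1$, $n\ge1$, are symmetric and all have the same distribution as a random variable $X$, then (2) implies (1).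
   Context: Notation: $m\vee n=\max\{m,n\}$, and limits as $m\vee n\to\infty$ are over pairs $(m,n)$ of positive integers with $\max\{m,n\}\to\infty$. $\mathbf{1}(\cdot)$ is the indicator function. In $Z_{mn,i,j}$ the first index is the product $mn$. Condition $(H_2)$: a family of random variables $\{X_\lambda,\lambda\in\Lambda\}$ (on a common probability space) satisfies Condition $(H_2)$ if there is a finite absolute constant $C$ (not depending on $I$ or on the functions $f_\lambda$) such that for every finite subset $I\subset\Lambda$ and every family of increasing (i.e. nondecreasing) functions $f_\lambda:\mathbb{R}\to\mathbb{R}$, $\lambda\in I$, $$\mathbb{E}\left|\sum_{\lambda\in I}\left(f_\lambda(X_\lambda)-\mathbb{E}f_\lambda(X_\lambda)\right)\right|^{2}\le C\left(|I|\max_{\lambda\in I}\mathbb{E}|f_\lambda(X_\lambda)|^{2}+|I|\max_{\lambda\in I}\mathbb{E}f_\lambda^2(X_\lambda)\right),$$ provided the expectations are finite. Here $|I|$ is the cardinality of $I$. Stochastic domination: a family $\{X_\lambda,\lambda\in\Lambda\}$ is stochastically dominated by a random variable $X$ if $\sup_{\lambda\in\Lambda}\mathbb{P}(|X_\lambda|>x)\le\mathbb{P}(|X|>x)$ for all $x\in\mathbb{R}$. *)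

(* Defs.v *)
From mathcomp Require Import all_boot all_order all_algebra finmap.
From mathcomp Require Import all_classical all_reals all_analysis.

Set Implicit Arguments.
Unset Strict Implicit.
Unset Printing Implicit Defensive.

Import Order.TTheory GRing.Theory Num.Theory.
Import numFieldNormedType.Exports.

Local Open Scope classical_set_scope.
Local Open Scope ring_scope.
Local Open Scope ereal_scope.

(* [nat] starts at 0: the arrays below are functions on [nat], and only their
   values at positive indices are ever constrained or used. *)
Definition pos_pairs : set (nat * nat) :=
  [set mn | (0 < mn.1)%N /\ (0 < mn.2)%N].

(* The filter "m \/ n -> oo" over pairs of positive integers; it is weaker than
   the product filter, since one of the two indices may stay bounded. *)
Definition maxn_pinfty : set_system (nat * nat) :=
  [set A | exists N : nat, forall mn : nat * nat,
     pos_pairs mn -> (N <= maxn mn.1 mn.2)%N -> A mn].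

Global Instance maxn_pinfty_proper_filter : ProperFilter maxn_pinfty.
Proof.
apply: Build_ProperFilter_ex => [A [N AN]|].
  by exists (N.+1, 1%N); apply: AN => //=; rewrite leq_max leqnSn.
split=> [|A B [N AN] [M BM]|A B AB [N AN]]; first by exists 0%N.
- exists (maxn N M) => mn mn0; rewrite geq_max => /andP[Nmn Mmn].
  by split; [exact: AN|exact: BM].
- by exists N => mn mn0 Nmn; apply/AB/AN.
Qed.

(* The index set of the family is a subset D of the choiceType L.  The maxima
   are over nonnegative quantities, hence the default value 0.
   Integrability of f_l(X_l) makes [fine] harmless; both integrability
   hypotheses together render "provided the expectations are finite". *)
Definition condition_H2 (R : realType) (d : measure_display)
    (T : measurableType d) (P : probability T R) (L : choiceType) (D : set L)
    (X : L -> {RV P >-> R}) : Prop :=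
  exists C : R, forall (I : {fset L}) (f : L -> R -> R),
    [set` I] `<=` D ->
    (forall l, l \in I -> {homo f l : x y / (x <= y)%R}) ->
    (forall l, l \in I ->
       P.-integrable setT (fun w => (f l (X l w))%:E) /\
       P.-integrable setT (fun w => (f l (X l w) ^+ 2)%:E)) ->
    'E_P[fun w => (`|\sum_(l <- I)
           (f l (X l w) - fine 'E_P[fun w' => f l (X l w')])| ^+ 2)%R] <=
    C%:E *
      ((#|` I|%fset)%:R%:E *
         \big[maxe/0]_(l <- I) 'E_P[fun w => (`|f l (X l w)| ^+ 2)%R] +
       (#|` I|%fset)%:R%:E *
         \big[maxe/0]_(l <- I) 'E_P[fun w => (f l (X l w) ^+ 2)%R]).

(* The dominating variable may live on another probability space. *)
Definition stochastically_dominated (R : realType) (d d' : measure_display)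
    (T : measurableType d) (P : probability T R)
    (T' : measurableType d') (P' : probability T' R)
    (L : Type) (D : set L) (X : L -> {RV P >-> R}) (Y : {RV P' >-> R}) : Prop :=
  forall x : R,
    ereal_sup [set P [set w | (x < `|X l w|)%R] | l in D] <=
    P' [set w | (x < `|Y w|)%R].

Definition same_distribution (R : realType) (d d' : measure_display)
    (T : measurableType d) (P : probability T R)
    (T' : measurableType d') (P' : probability T' R)
    (X : {RV P >-> R}) (Y : {RV P' >-> R}) : Prop :=
  forall A : set R, measurable A -> distribution P X A = distribution P' Y A.

Definition symmetric_rv (R : realType) (d : measure_display)
    (T : measurableType d) (P : probability T R) (X : {RV P >-> R}) : Prop :=
  forall A : set R, measurable A ->
    P [set w | A (X w)] = P [set w | A (- X w)%R].

Definition cvg_in_probability (R : realType) (d : measure_display)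
    (T : measurableType d) (P : probability T R) (K : Type)
    (F : set_system K) (Y : K -> T -> R) (l : R) : Prop :=
  forall e : R, (0 < e)%R ->
    P [set w | (e < `|Y k w - l|)%R] @[k --> F] --> 0.

Section double_array.
Context (R : realType) (d : measure_display) (T : measurableType d).
Context (P : probability T R) (p : R) (X : nat -> nat -> {RV P >-> R}).

Definition trunc_level (n : nat) : R := (n%:R `^ p^-1)%R.

(* Bounded, hence integrable: its expectation is a genuine real number. *)
Definition trunc_rv (n i j : nat) (w : T) : R :=
  (X i j w * \1_[set w' | `|X i j w'| <= trunc_level n] w)%R.

Definition max_partial_sum (m n : nat) (w : T) : R :=
  (\big[Num.max/0]_(1 <= u < m.+1) \big[Num.max/0]_(1 <= v < n.+1)
     `|\sum_(1 <= i < u.+1) \sum_(1 <= j < v.+1)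
         (X i j w - fine 'E_P[trunc_rv (m * n) i j])|)%R.

Definition weak_law : Prop :=
  cvg_in_probability P maxn_pinfty
    (fun mn w => (max_partial_sum mn.1 mn.2 w /
                  (mn.1 * mn.2)%:R `^ p^-1)%R) 0%R.

End double_array.

Definition tail_condition (R : realType) (d : measure_display)
    (T : measurableType d) (P : probability T R) (p : R)
    (X : {RV P >-> R}) : Prop :=
  n%:R%:E * P [set w | (n%:R `^ p^-1 < `|X w|)%R] @[n --> \oo] --> 0.

(* Main.v *)
Require Import Defs.
From mathcomp Require Import all_boot all_order all_algebra finmap.
From mathcomp Require Import all_classical all_reals all_analysis.
From mathcomp Require Import measurable_realfun.
From mathcomp Require Import ring lra zify.

(** Write b_q = 2^(q/p), and let clip c x = min(max(x, 0), c).

    Sufficiency.  Everything is done at dyadic sizes: m < 2^k <= 2m,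
    n < 2^l <= 2n, N = k + l, so that b_N is comparable with (mn)^(1/p).
    The maximum is controlled by dyadic chaining.  With all the summands
    truncated at the top level b_N, variance bounds would only give this up to
    logarithmic factors; the truncation is therefore adapted to the scale: the
    sum over a dyadic rectangle of area 2^q only involves variables truncated
    at b_q.  Passing from level q-1 to level q on a rectangle of area 2^q adds
    the increments clip b_q - clip b_(q-1).  These are nonnegative, so that a sum of increments over a sub-rectangle is
    bounded by the sum over the whole rectangle, up to the total mean, and the
    maximum over sub-rectangles costs nothing ([dyadic_chaining2],
    [rsum_centered_sub_le]).  Nonnegativity is obtained by treating X and -X
    separately.  Both clip c and its increments are nondecreasing functions of
    the variable, hence Condition (H2) bounds the variance of their sums over a
    rectangle by its area times the second moment ([condition_H2_variance]).

    There are 2^(N-q) rectangles of area 2^q and given shape, so their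
    variances add up to 2^N E(clip b_q X)^2.  The tail condition gives
    E(clip b_q X)^2 = o(b_q^2 / 2^q), and compared with b_N^2 the total is
    o(1) 2^(-(N-q)(2/p-1)): a geometric factor in N - q which, because p < 2,
    beats the number of shapes, and leaves room for thresholds that themselves
    decay geometrically in N - q.  Summing the thresholds bounds the maximum
    ([adaptive_maximal_inequality], [clip_maximal_inequality]).  To avoid
    convolutions of the tail with geometric sequences, the tail 2^q P(|X| > b_q)
    is first replaced by a majorant h that still tends to 0 but never drops
    faster than b^q, where b^4 = 2 / 2^(2/p) ([slow_majorant]).

    Necessity.  By symmetry the centering vanishes, and a single variable of
    the column X(1,1), ..., X(n,1) exceeding b = n^(1/p) forces the maximal
    partial sum above b / 2.  Let S count the exceedances X(i,1) > b, so that
    S > 0 has a probability tending to 0.  By (H2), S has variance at most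
    a constant times its mean; a variable with this property cannot have a mean
    bounded away from 0 and yet vanish with probability close to 1
    ([exceedance_count_le]).  Hence E S = n P(X > b) tends to 0. *)

Set Implicit Arguments.
Unset Strict Implicit.
Unset Printing Implicit Defensive.

Import Order.TTheory GRing.Theory Num.Theory.
Import numFieldNormedType.Exports.

Local Open Scope classical_set_scope.
Local Open Scope ring_scope.

(** * Dyadic chaining with level-dependent summands *)

Section dyadic_chaining.
Variable R : realFieldType.
Implicit Types (Y : nat -> nat -> nat -> R) (F G : nat -> nat -> R) (A D B : nat -> R).

(** [F t i] is the i-th summand at truncation level t.  Rounding v down to a
    multiple of 2^t, for t = 0, ..., l, splits [0, v) into dyadic blocks of
    decreasing lengths 2^t; on the block of length 2^t the level is lowered
    from l to t, one unit at a time.  The drop from t+1 to t is performed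
    simultaneously on all that remains of [0, v) past the multiple of 2^(t+1),
    that is, on an initial piece of one block of length 2^(t+1). *)
Lemma dyadic_chaining F A D l v :
  (forall t a, (t < l)%N -> (a.+1 * 2 ^ t <= 2 ^ l)%N ->
    `|\sum_(a * 2 ^ t <= i < a.+1 * 2 ^ t) F t i| <= A t) ->
  (forall t a y, (t < l)%N -> (a.+1 * 2 ^ t.+1 <= 2 ^ l)%N ->
    (a * 2 ^ t.+1 <= y <= a.+1 * 2 ^ t.+1)%N ->
    `|\sum_(a * 2 ^ t.+1 <= i < y) (F t.+1 i - F t i)| <= D t) ->
  (v < 2 ^ l)%N ->
  `|\sum_(0 <= i < v) F l i| <= \sum_(t < l) (A t + D t).
Proof.
move=> hA hD vl.
(* Telescoping: the remainder of v modulo 2^r is summed at level r. *)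
suff H r : (r <= l)%N ->
    `|\sum_(v %/ 2 ^ r * 2 ^ r <= i < v) F r i| <= \sum_(t < r) (A t + D t).
  by have := H l (leqnn l); rewrite divn_small// mul0n.
elim: r => [_|r IH rl].
  by rewrite expn0 divn1 muln1 big_geq// normr0 big_ord0.
set a := (v %/ 2 ^ r)%N.
have aE : (v %/ 2 ^ r.+1 = a./2)%N by rewrite expnSr divnMA divn2.
have av : (a * 2 ^ r <= v)%N by rewrite leq_trunc_div.
have xa : (a./2 * 2 ^ r.+1 <= a * 2 ^ r)%N.
  by rewrite expnS mulnA leq_mul2r muln2 -[X in (_ <= X)%N]odd_double_half leq_addl orbT.
have lt_block s : (s <= l)%N -> ((v %/ 2 ^ s).+1 * 2 ^ s <= 2 ^ l)%N.
  move=> sl; rewrite -(subnK sl) expnD leq_mul2r expn_eq0/=.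
  by rewrite ltn_divLR ?expn_gt0// -expnD subnK.
rewrite aE big_ord_recr/=.
have -> : \sum_(a./2 * 2 ^ r.+1 <= i < v) F r.+1 i =
    \sum_(a * 2 ^ r <= i < v) F r i + (\sum_(a./2 * 2 ^ r.+1 <= i < a * 2 ^ r) F r i
    + \sum_(a./2 * 2 ^ r.+1 <= i < v) (F r.+1 i - F r i)).
  rewrite addrA [X in _ = X + _]addrC -big_cat_nat//= -big_split/=.
  by apply: eq_bigr => i _; rewrite addrC subrK.
apply: (le_trans (ler_normD _ _)); apply: lerD; first exact/IH/ltnW.
apply: (le_trans (ler_normD _ _)); apply: lerD; last first.
  rewrite -aE; apply: hD => //; first exact: lt_block.
  rewrite leq_trunc_div/= ltnW//.
  by rewrite -ltn_divLR ?expn_gt0.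
have [ao|ae] := boolP (odd a).
  have a1 : a = (a./2 * 2).+1 by rewrite -[LHS]odd_double_half ao muln2.
  rewrite {2}a1 expnS mulnA.
  by apply: hA => //; rewrite -a1; exact: leq_trans av (ltnW vl).
have a1 : a = (a./2 * 2)%N by rewrite -[LHS]odd_double_half (negPf ae) muln2.
(* An even quotient contributes the empty block; A r is nonnegative because it
   bounds an absolute value. *)
rewrite {2}a1 -mulnA -expnS big_geq// normr0.
by apply: le_trans (hA r 0%N rl _) => //; rewrite mul1n leq_exp2l// ltnW.
Qed.

Definition rsum F x0 x1 y0 y1 := \sum_(x0 <= i < x1) \sum_(y0 <= j < y1) F i j.

(** Chaining in the first coordinate at levels s + l, then, inside each block of
    width 2^s, in the second coordinate at levels s + t: in both directions a
    level drop from q to q - 1 only ever occurs inside a dyadic rectangle of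
    area 2^q.  The value of [Y q.-1] at q = 0 is harmless, the difference being
    then 0. *)
Lemma dyadic_chaining2 Y B k l u v :
  (forall s t a b, (s <= k)%N -> (t <= l)%N ->
    (a.+1 * 2 ^ s <= 2 ^ k)%N -> (b.+1 * 2 ^ t <= 2 ^ l)%N ->
    `|rsum (Y (s + t)%N) (a * 2 ^ s) (a.+1 * 2 ^ s) (b * 2 ^ t) (b.+1 * 2 ^ t)|
      <= B (s + t)%N) ->
  (forall s t a b x y, (s <= k)%N -> (t <= l)%N ->
    (a.+1 * 2 ^ s <= 2 ^ k)%N -> (b.+1 * 2 ^ t <= 2 ^ l)%N ->
    (a * 2 ^ s <= x <= a.+1 * 2 ^ s)%N -> (b * 2 ^ t <= y <= b.+1 * 2 ^ t)%N ->
    `|rsum (fun i j => Y (s + t)%N i j - Y (s + t).-1 i j)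
        (a * 2 ^ s) x (b * 2 ^ t) y| <= B (s + t)%N) ->
  (u < 2 ^ k)%N -> (v < 2 ^ l)%N ->
  `|rsum (Y (k + l)%N) 0 u 0 v| <=
    \sum_(s < k) (\sum_(t < l) (B (s + t)%N + B (s + t).+1) + B (s + l).+1).
Proof.
move=> hB hD uk vl.
apply: (@dyadic_chaining (fun s i => \sum_(0 <= j < v) Y (s + l)%N i j)
  (fun s => \sum_(t < l) (B (s + t)%N + B (s + t).+1)) (fun s => B (s + l).+1)) => //.
- move=> s a sk ak; rewrite exchange_big/=.
  apply: (@dyadic_chaining (fun t j => \sum_(a * 2 ^ s <= i < a.+1 * 2 ^ s) Y (s + t)%N i j)
    (fun t => B (s + t)%N) (fun t => B (s + t).+1)) => //.
  + by move=> t b tl bl; rewrite exchange_big/=; apply: hB => //; exact: ltnW.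
  + move=> t b y tl bl yb.
    under eq_bigr do rewrite -sumrB.
    rewrite exchange_big/= addnS -[(s + t)%N]/((s + t).+1.-1) -addnS.
    by apply: hD => //; [exact: ltnW|rewrite leq_mul2r leqnSn orbT leqnn].
- move=> s a x sk ak xa.
  under eq_bigr do rewrite -sumrB.
  rewrite addSn -[(s + l)%N]/((s + l).+1.-1) -addSn.
  have := hD s.+1 l a 0%N x v sk (leqnn l) ak.
  by rewrite mul0n mul1n leqnn => /(_ isT xa); apply; exact: ltnW.
Qed.

End dyadic_chaining.

(** * Geometric sums and sums over rectangles *)

Section geometric.
Variables (R : realFieldType) (b : R).

Lemma geometric_sum_le k : 0 < b -> b < 1 ->
  \sum_(s < k.+1) b ^+ (k - s) <= (1 - b)^-1.
Proof.
move=> b0 b1; have b1' : 0 < 1 - b by rewrite subr_gt0.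
elim: k => [|k IH].
  by rewrite big_ord1 subnn expr0 invf_ge1//; lra.
rewrite big_ord_recr/= subnn expr0.
have -> : \sum_(i < k.+1) b ^+ (k.+1 - i) = b * \sum_(i < k.+1) b ^+ (k - i).
  by rewrite mulr_sumr; apply: eq_bigr => i _; rewrite subSn -1?ltnS// exprS.
have -> : (1 - b)^-1 = b * (1 - b)^-1 + 1 by field; lra.
by rewrite lerD2r ler_pM2l.
Qed.

Lemma geometric_sum2_le k l : 0 < b -> b < 1 ->
  \sum_(s < k.+1) \sum_(t < l.+1) b ^+ ((k - s) + (l - t)) <= ((1 - b)^-1) ^+ 2.
Proof.
move=> b0 b1; under eq_bigr => s _.
  under eq_bigr do rewrite exprD.
  rewrite -mulr_sumr.
over.
rewrite -mulr_suml expr2 ler_pM ?geometric_sum_le ?sumr_ge0// => *; exact/exprn_ge0/ltW.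
Qed.

(** The bound produced by [dyadic_chaining2] when the bound at level q is
    geometric in the distance of q to the top level k + l. *)
Lemma chaining_budget_le (B : nat -> R) (K : R) k l : 0 < b -> b < 1 ->
  (forall q, (q <= k + l)%N -> B q <= K * b ^+ (k + l - q)) -> 0 <= K ->
  \sum_(s < k) (\sum_(t < l) (B (s + t)%N + B (s + t).+1) + B (s + l).+1)
    <= 3 * K * ((1 - b)^-1) ^+ 2.
Proof.
move=> b0 b1 hB K0; set g := (1 - b)^-1.
have g1 : 1 <= g by rewrite invf_ge1; lra.
case: k hB => [_|k hB].
  by rewrite big_ord0 !mulr_ge0// ?exprn_ge0//; lra.
have bX m n : (n <= m)%N -> b ^+ m <= b ^+ n.
  by move=> mn; rewrite ler_wiXn2l// ltW.
have hin (s : 'I_k.+1) : \sum_(t < l) (B (s + t)%N + B (s + t).+1) + B (s + l).+1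
    <= (3 * K * g) * b ^+ (k - s).
  have sk : (s <= k)%N by rewrite -ltnS.
  have -> : 3 * K * g * b ^+ (k - s) = 2 * K * b ^+ (k - s) * g + K * g * b ^+ (k - s) by ring.
  apply: lerD; last first.
    apply: (le_trans (hB _ _)); first by lia.
    have -> : (k.+1 + l - (s + l).+1 = k - s)%N by lia.
    by rewrite ler_wpM2r ?exprn_ge0 ?(ltW b0)// ler_peMr.
  case: l hB => [|l] hB.
    by rewrite big_ord0 !mulr_ge0// ?exprn_ge0//; lra.
  apply: (@le_trans _ _ (\sum_(t < l.+1) 2 * K * b ^+ (k - s) * b ^+ (l - t))).
    apply: ler_sum => t _.
    have tl : (t <= l)%N by rewrite -ltnS.
    have -> : 2 * K * b ^+ (k - s) * b ^+ (l - t) =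
      K * b ^+ (k - s + (l - t)) + K * b ^+ (k - s + (l - t)) by rewrite exprD; ring.
    by apply: lerD; (apply: (le_trans (hB _ _)); [lia|rewrite ler_wpM2l// bX//; lia]).
  rewrite -mulr_sumr ler_wpM2l ?geometric_sum_le// !mulr_ge0// ?exprn_ge0//; lra.
apply: (le_trans (ler_sum _ (fun s _ => hin s))).
rewrite -mulr_sumr expr2 mulrA ler_wpM2l ?geometric_sum_le// !mulr_ge0//; lra.
Qed.

End geometric.

Section rsum.
Variable R : realFieldType.
Implicit Types (F G : nat -> nat -> R).

Lemma le_rsum F G x0 x1 y0 y1 : (forall i j, F i j <= G i j) ->
  rsum F x0 x1 y0 y1 <= rsum G x0 x1 y0 y1.
Proof. by move=> FG; apply: ler_sum => i _; apply: ler_sum => j _. Qed.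

Lemma rsum_ge0 F x0 x1 y0 y1 : (forall i j, 0 <= F i j) ->
  0 <= rsum F x0 x1 y0 y1.
Proof. by move=> F0; apply: sumr_ge0 => i _; apply: sumr_ge0 => j _. Qed.

Lemma rsumB F G x0 x1 y0 y1 :
  rsum (fun i j => F i j - G i j) x0 x1 y0 y1 = rsum F x0 x1 y0 y1 - rsum G x0 x1 y0 y1.
Proof. by rewrite /rsum -sumrB; apply: eq_bigr => i _; rewrite sumrB. Qed.

Lemma rsum_cst c x0 x1 y0 y1 :
  rsum (fun _ _ => c : R) x0 x1 y0 y1 = ((x1 - x0) * (y1 - y0))%:R * c.
Proof.
by rewrite /rsum; under eq_bigr do rewrite sumr_const_nat;
   rewrite sumr_const_nat -mulrnA mulnC mulr_natl.
Qed.

Lemma rsum_sub_le F x0 x x1 y0 y y1 : (forall i j, 0 <= F i j) ->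
  (x0 <= x <= x1)%N -> (y0 <= y <= y1)%N ->
  rsum F x0 x y0 y <= rsum F x0 x1 y0 y1.
Proof.
move=> F0 /andP[x0x xx1] /andP[y0y yy1].
rewrite /rsum [leRHS](@big_cat_nat _ _ _ x)//= -[leLHS]addr0 lerD//; last first.
  by apply: sumr_ge0 => i _; exact: sumr_ge0.
apply: ler_sum => i _.
rewrite [leRHS](@big_cat_nat _ _ _ y)//= -[leLHS]addr0 lerD//.
exact: sumr_ge0.
Qed.

(** Monotonicity replaces a maximal inequality: for nonnegative summands the
    centered sum over an initial sub-rectangle lies between minus the total mean
    and the centered sum over the full rectangle plus the total mean. *)
Lemma rsum_centered_sub_le F G x0 x x1 y0 y y1 m :
  (forall i j, 0 <= F i j) -> (forall i j, 0 <= G i j <= m) ->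
  (x0 <= x <= x1)%N -> (y0 <= y <= y1)%N ->
  `|rsum (fun i j => F i j - G i j) x0 x y0 y| <=
  `|rsum (fun i j => F i j - G i j) x0 x1 y0 y1| + ((x1 - x0) * (y1 - y0))%:R * m.
Proof.
move=> F0 Gm xx yy.
have G0 i j : 0 <= G i j by case/andP: (Gm i j).
rewrite !rsumB.
have hG : rsum G x0 x1 y0 y1 <= ((x1 - x0) * (y1 - y0))%:R * m.
  by rewrite -rsum_cst; apply: le_rsum => i j; case/andP: (Gm i j).
have := rsum_sub_le F0 xx yy; have := rsum_sub_le G0 xx yy.
have := rsum_ge0 x0 x y0 y F0; have := rsum_ge0 x0 x y0 y G0.
move: hG.
move: (rsum F x0 x y0 y) (rsum G x0 x y0 y) => a c.
move: (rsum F x0 x1 y0 y1) (rsum G x0 x1 y0 y1) => A C.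
move: (_ * m) => M h1 h2 h3 h4 h5.
have := ler_norm (A - C); have := normr_ge0 (A - C) => h6 h7.
by rewrite ler_norml; apply/andP; split; lra.
Qed.

End rsum.

(** * Nonnegative random variables with bounded mean *)

Lemma indic_bool (R : pzRingType) (U : Type) (p : pred U) (x : U) :
  \1_[set y | p y] x = (p x)%:R :> R.
Proof. by rewrite indicE; congr (nat_of_bool _)%:R; apply/idP/idP; rewrite inE. Qed.

Section mean_le.
Context (R : realType) (d : measure_display) (T : measurableType d).
Variable P : probability T R.
Implicit Types (f g : T -> R) (x y : R).

(** Measurability, nonnegativity and the bound travel together, which makes
    upper bounds on expectations closed under finite sums and scaling without
    integrability side conditions. *)
Definition mean_le f x : Prop :=
  [/\ measurable_fun setT f, (forall w, 0 <= f w) & ('E_P[f] <= x%:E)%E].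

Lemma mean_leW f x y : x <= y -> mean_le f x -> mean_le f y.
Proof. by move=> xy [mf f0 fx]; split=> //; apply: le_trans fx _; rewrite lee_fin. Qed.

Lemma mean_leS f g x : measurable_fun setT f -> (forall w, 0 <= f w <= g w) ->
  mean_le g x -> mean_le f x.
Proof.
move=> mf fg [mg g0 gx]; have f0 w : 0 <= f w by case/andP: (fg w).
split=> //; apply: le_trans gx; apply: expectation_le => //.
by apply: aeW => w; case/andP: (fg w).
Qed.

Lemma mean_leZ c f x : 0 <= c -> mean_le f x -> mean_le (fun w => c * f w) (c * x).
Proof.
move=> c0 [mf f0 fx]; split.
- exact: measurable_funM.
- by move=> w; rewrite mulr_ge0.
- rewrite unlock in fx *; under eq_integral do rewrite EFinM.
  rewrite ge0_integralZl_EFin//.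
  + by rewrite EFinM lee_wpmul2l// lee_fin.
  + by move=> w _; rewrite lee_fin.
  + exact/measurable_EFinP.
Qed.

Lemma mean_le_sum (I : Type) (s : seq I) (f : I -> T -> R) (x : I -> R) :
  (forall i, mean_le (f i) (x i)) ->
  mean_le (fun w => \sum_(i <- s) f i w) (\sum_(i <- s) x i).
Proof.
move=> fx; split.
- by apply: measurable_sum => i; case: (fx i).
- by move=> w; apply: sumr_ge0 => i _; case: (fx i).
- rewrite unlock; under eq_integral do rewrite -sumEFin.
  rewrite ge0_integral_sum//.
  + by rewrite -sumEFin; apply: lee_sum => i _; case: (fx i); rewrite unlock.
  + by move=> i; apply/measurable_EFinP; case: (fx i).
  + by move=> i w _; rewrite lee_fin; case: (fx i).
Qed.

Lemma mean_leD f g x y : mean_le f x -> mean_le g y ->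
  mean_le (fun w => f w + g w) (x + y).
Proof.
move=> fx gy.
have := @mean_le_sum bool [:: true; false] (fun b => if b then f else g)
  (fun b => if b then x else y).
rewrite !big_cons big_nil addr0/=.
under eq_fun do rewrite !big_cons big_nil addr0.
by apply; case.
Qed.

Lemma mean_le_indic (A : set T) x : measurable A -> (P A <= x%:E)%E ->
  mean_le (\1_A : T -> R) x.
Proof.
move=> mA Ax; split=> [||]; [exact: measurable_indic| |by rewrite expectation_indic].
by move=> w; rewrite indicE.
Qed.

Lemma mean_le_cst x : 0 <= x -> mean_le (cst x) x.
Proof. by move=> x0; split=> //; rewrite expectation_cst. Qed.

Lemma mean_le_ge0 f x : mean_le f x -> 0 <= x.
Proof. by move=> [mf f0 fx]; rewrite -lee_fin (le_trans _ fx)// expectation_ge0. Qed.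

Lemma mean_le_markov f x : mean_le f x ->
  measurable [set w | 1 <= f w] /\ (P [set w | (1 <= f w)%R] <= x%:E)%E.
Proof.
move=> [mf f0 fx].
have mA : measurable [set w | 1 <= f w].
  have := measurable_fun_ler (@measurable_cst _ _ _ _ setT (1 : R)) mf.
  by move=> /(_ measurableT [set true] I); rewrite setTI.
split=> //; apply: le_trans fx; rewrite -expectation_indic//.
apply: expectation_le => //.
by apply: aeW => w; rewrite indicE; case: (boolP (w \in _)) => [|_//]; rewrite inE.
Qed.

Lemma measurable_gt (Z : T -> R) (c : R) : measurable_fun setT Z ->
  measurable [set w | c < Z w].
Proof.
move=> mZ; have := measurable_fun_ltr (@measurable_cst _ _ _ _ setT c) mZ.
by move=> /(_ measurableT [set true] I); rewrite setTI.
Qed.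

Lemma measurable_tail (Z : T -> R) (c : R) : measurable_fun setT Z ->
  measurable [set w | c < `|Z w|].
Proof. by move=> mZ; apply: measurable_gt; exact: measurableT_comp. Qed.

Lemma measurable_norm_le (Z : T -> R) (c : R) : measurable_fun setT Z ->
  measurable [set w | `|Z w| <= c].
Proof.
move=> mZ; rewrite (_ : [set _ | _] = ~` [set w | c < `|Z w|]).
  by apply: measurableC; exact: measurable_tail.
by apply/seteqP; split=> w /=; [rewrite leNgt => /negP|move=> /negP; rewrite -leNgt].
Qed.

Lemma mean_le_fine (f : T -> R) x : mean_le f x -> fine 'E_P[f] <= x.
Proof.
move=> [mf f0 fx]; have E0 : (0 <= 'E_P[f])%E by exact: expectation_ge0.
rewrite -lee_fin fineK// ge0_fin_numE//; exact: le_lt_trans fx (ltry _).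
Qed.

End mean_le.

(** * The maximal inequality *)

Section maximal.
Context (R : realType) (d : measure_display) (T : measurableType d).
Variable P : probability T R.
Implicit Types (W : nat -> nat -> nat -> T -> R) (e : nat -> nat -> nat -> R).

Lemma dyadic_index_lt s k a : (s <= k)%N -> (a.+1 * 2 ^ s <= 2 ^ k)%N ->
  (a < 2 ^ (k - s))%N.
Proof. by move=> sk; rewrite -{1}(subnK sk) expnD leq_mul2r expn_eq0. Qed.

Lemma term_le_sum (n : nat) (F : nat -> R) i : (i < n)%N ->
  (forall j, 0 <= F j) -> F i <= \sum_(j < n) F j.
Proof.
by move=> i_n F0; rewrite (bigD1 (Ordinal i_n))//= lerDl; exact: sumr_ge0.
Qed.

Lemma measurable_rsum (Z : nat -> nat -> T -> R) (c : nat -> nat -> R) x0 x1 y0 y1 :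
  (forall i j, measurable_fun setT (Z i j)) ->
  measurable_fun setT (fun w => rsum (fun i j => Z i j w - c i j) x0 x1 y0 y1).
Proof.
move=> mZ; apply: measurable_sum => i; apply: measurable_sum => j.
exact: measurable_funB.
Qed.

(** [W q] is the array truncated at level q and [e q] its centering.  The
    exceptional event is that some dyadic rectangle of area 2^q carries a
    centered sum, or a centered sum of increments, larger than a b^(N - q).
    The 2^(N - q) rectangles of a given shape have total variance 2^N V_q,
    which is assumed to be at most v b^(3(N - q)); dividing by the squared
    threshold leaves b^(N - q), summable over all shapes. *)
Lemma adaptive_maximal_inequality W e (V m : nat -> R) (b v M a : R) k l :
  0 < b -> b < 1 -> 0 < a -> 0 <= M -> 0 <= v ->
  (forall q w i j, W q i j w <= W q.+1 i j w) ->
  (forall q i j, 0 <= e q.+1 i j - e q i j <= m q) ->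
  (forall q, (q < k + l)%N -> 2 ^+ q.+1 * m q <= M * b ^+ (k + l - q.+1)) ->
  (forall q x0 x1 y0 y1,
    mean_le P (fun w => rsum (fun i j => W q i j w - e q i j) x0 x1 y0 y1 ^+ 2)
      (((x1 - x0) * (y1 - y0))%:R * V q)) ->
  (forall q x0 x1 y0 y1,
    mean_le P (fun w => rsum (fun i j => (W q.+1 i j w - W q i j w) -
                                         (e q.+1 i j - e q i j)) x0 x1 y0 y1 ^+ 2)
      (((x1 - x0) * (y1 - y0))%:R * V q.+1)) ->
  (forall q, (q <= k + l)%N -> 2 ^+ (k + l) * V q <= v * b ^+ (3 * (k + l - q))) ->
  exists Bad : set T, [/\ measurable Bad,
    (P Bad <= (2 * v / a ^+ 2 * ((1 - b)^-1) ^+ 2)%:E)%E &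
    forall w, ~ Bad w -> forall u v, (u < 2 ^ k)%N -> (v < 2 ^ l)%N ->
      `|rsum (fun i j => W (k + l)%N i j w - e (k + l)%N i j) 0 u 0 v|
        <= 3 * (a + M) * ((1 - b)^-1) ^+ 2].
Proof.
move=> b0 b1 a0 M0 v0 Wm em hm hW hD hV.
set N := (k + l)%N in hm hV *.
pose Y q w i j := W q i j w - e q i j.
pose D q w i j := (W q i j w - W q.-1 i j w) - (e q i j - e q.-1 i j).
pose al q := a * b ^+ (N - q).
have al0 q : 0 < al q by rewrite mulr_gt0// exprn_gt0.
have hD' q x0 x1 y0 y1 : mean_le P (fun w => rsum (D q w) x0 x1 y0 y1 ^+ 2)
      (((x1 - x0) * (y1 - y0))%:R * V q).
  case: q => [|q]; last exact: hD.
  have V0 : 0 <= V 0%N by have := mean_le_ge0 (hW 0%N 0%N 1%N 0%N 1%N); rewrite mul1r.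
  rewrite (_ : (fun w => _) = cst 0).
    by apply: mean_leW (mean_le_cst P (lexx 0)); rewrite mulr_ge0.
  apply/funext => w; rewrite /rsum big1 ?expr0n// => i _; rewrite big1// => j _.
  by rewrite /D !subrr.
pose blk F s t x y : R :=
  rsum F (x * 2 ^ s) (x.+1 * 2 ^ s) (y * 2 ^ t) (y.+1 * 2 ^ t).
pose term s t x y w : R := (al (s + t)%N ^+ 2)^-1 *
  (blk (Y (s + t)%N w) s t x y ^+ 2 + blk (D (s + t)%N w) s t x y ^+ 2).
(* All the exceptional rectangles are handled by one application of Markov's
   inequality: if Q w < 1 then every normalised square is below 1. *)
pose Q w : R := \sum_(s < k.+1) \sum_(t < l.+1) \sum_(x < 2 ^ (k - s))
  \sum_(y < 2 ^ (l - t)) term s t x y w.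
have tmean s t x y : mean_le P (term s t x y)
    ((al (s + t)%N ^+ 2)^-1 * ((2 ^ (s + t))%:R * V (s + t)%N * 2)).
  apply: mean_leZ; first by rewrite invr_ge0 sqr_ge0.
  rewrite mulr_natr mulr2n.
  have sz : (2 ^ (s + t))%N =
    ((x.+1 * 2 ^ s - x * 2 ^ s) * (y.+1 * 2 ^ t - y * 2 ^ t))%N.
    by rewrite -!mulnBl !subSnn !mul1n expnD.
  by apply: mean_leD; rewrite sz; [exact: hW|exact: hD'].
have t0 s t x y w : 0 <= term s t x y w by case: (tmean s t x y).
have Qmean : mean_le P Q (2 * v / a ^+ 2 * ((1 - b)^-1) ^+ 2).
  have := mean_le_sum (index_enum 'I_k.+1) (fun s =>
    mean_le_sum (index_enum 'I_l.+1) (fun t =>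
    mean_le_sum (index_enum 'I_(2 ^ (k - s))) (fun x =>
    mean_le_sum (index_enum 'I_(2 ^ (l - t))) (fun y => tmean s t x y)))).
  apply: mean_leW.
  apply: (@le_trans _ _ (\sum_(s < k.+1) \sum_(t < l.+1)
     2 * v / a ^+ 2 * b ^+ ((k - s) + (l - t)))); last first.
    under eq_bigr do rewrite -mulr_sumr.
    rewrite -mulr_sumr ler_wpM2l ?geometric_sum2_le//.
    by rewrite divr_ge0 ?sqr_ge0// mulr_ge0.
  apply: ler_sum => s _; apply: ler_sum => t _.
  have sk : (s <= k)%N by rewrite -ltnS.
  have tl : (t <= l)%N by rewrite -ltnS.
  rewrite !sumr_const !card_ord -!mulrnA -[leLHS]mulr_natr.
  set q := (s + t)%N.
  have Nq : (N - q = (k - s) + (l - t))%N by rewrite /N /q; lia.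
  have qN : (q <= N)%N by rewrite /N /q; lia.
  have -> : ((2 ^ (l - t) * 2 ^ (k - s))%:R : R) = 2 ^+ (N - q).
    by rewrite -expnD natrX Nq addnC.
  rewrite natrX -Nq.
  have h2 : (2 : R) ^+ N = 2 ^+ q * 2 ^+ (N - q) by rewrite -exprD subnKC.
  have -> : (al q ^+ 2)^-1 * (2 ^+ q * V q * 2) * 2 ^+ (N - q) =
     2 * (al q ^+ 2)^-1 * (2 ^+ N * V q) by rewrite h2; ring.
  apply: (le_trans (ler_wpM2l _ (hV q qN))).
    by rewrite mulr_ge0// invr_ge0 sqr_ge0.
  rewrite le_eqVlt; apply/orP; left; apply/eqP.
  rewrite /al mulnC exprM.
  have := lt0r_neq0 (exprn_gt0 (N - q) b0); move: (b ^+ _) => z z0.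
  by field; rewrite z0 lt0r_neq0.
have [mBad PBad] := mean_le_markov Qmean.
exists [set w | 1 <= Q w]; split => // w /negP; rewrite -ltNge => Q1 u' v' uk vl.
have small s t x y : (s <= k)%N -> (t <= l)%N ->
    (x.+1 * 2 ^ s <= 2 ^ k)%N -> (y.+1 * 2 ^ t <= 2 ^ l)%N ->
    `|blk (Y (s + t)%N w) s t x y| <= al (s + t)%N /\
    `|blk (D (s + t)%N w) s t x y| <= al (s + t)%N.
  move=> sk tl xk yl.
  have : term s t x y w < 1.
    apply: le_lt_trans Q1.
    apply: (@le_trans _ _ (\sum_(y < 2 ^ (l - t)) term s t x y w)).
      by apply: (@term_le_sum _ (fun y => term s t x y w)) => //; exact: dyadic_index_lt.
    apply: (@le_trans _ _ (\sum_(x < 2 ^ (k - s)) \sum_(y < 2 ^ (l - t)) term s t x y w)).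
      apply: (@term_le_sum _ (fun x => \sum_(y < 2 ^ (l - t)) term s t x y w)) => //.
        exact: dyadic_index_lt.
      by move=> ?; exact: sumr_ge0.
    apply: (@le_trans _ _ (\sum_(t < l.+1) \sum_(x < 2 ^ (k - s))
      \sum_(y < 2 ^ (l - t)) term s t x y w)).
      apply: (@term_le_sum _ (fun t => \sum_(x < 2 ^ (k - s))
        \sum_(y < 2 ^ (l - t)) term s t x y w)) => //.
      by move=> ?; do 2 apply: sumr_ge0 => ? _.
    apply: (@term_le_sum _ (fun s => \sum_(t < l.+1) \sum_(x < 2 ^ (k - s))
      \sum_(y < 2 ^ (l - t)) term s t x y w)) => //.
    by move=> ?; do 3 apply: sumr_ge0 => ? _.
  rewrite /term mulrC ltr_pdivrMr ?exprn_gt0// mul1r => /ltW h.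
  by split; rewrite -(@ler_pXn2r _ 2) ?nnegrE ?normr_ge0 ?(ltW (al0 _))// real_normK ?num_real//;
    apply: le_trans h; rewrite ?lerDl ?lerDr sqr_ge0.
apply: le_trans (@chaining_budget_le _ _ (fun q => (a + M) * b ^+ (N - q))
  (a + M) k l b0 b1 _ _) => //; last first.
  by rewrite addr_ge0// ltW.
apply: (@dyadic_chaining2 _ (fun q i j => W q i j w - e q i j)
  (fun q => (a + M) * b ^+ (N - q))) => //.
- move=> s t x y sk tl xk yl.
  have [h _] := small s t x y sk tl xk yl; apply: le_trans h _.
  by rewrite /al ler_wpM2r ?exprn_ge0 ?(ltW b0)// lerDl.
- move=> s t x y x' y' sk tl xk yl xx yy.
  have [_ h] := small s t x y sk tl xk yl.
  set q := (s + t)%N in h *.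
  have -> : rsum (fun i j => W q i j w - e q i j - (W q.-1 i j w - e q.-1 i j)) 
     (x * 2 ^ s) x' (y * 2 ^ t) y' = rsum (D q w) (x * 2 ^ s) x' (y * 2 ^ t) y'.
    by apply: eq_bigr => i _; apply: eq_bigr => j _; rewrite /D; ring.
  case: (posnP q) => [q0|q0].
    rewrite /rsum big1 ?normr0; last first.
      by move=> i _; apply: big1 => j _; rewrite /D q0 !subrr.
    by rewrite mulr_ge0 ?exprn_ge0 ?(ltW b0)// addr_ge0// ltW.
  have qN : (q <= N)%N by rewrite /N /q; lia.
  have qE : q = q.-1.+1 by rewrite prednK.
  apply: (le_trans (@rsum_centered_sub_le _ _ _ _ _ (x.+1 * 2 ^ s) _ _ (y.+1 * 2 ^ t)
    (m q.-1) _ _ xx yy)).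
  + by move=> i j; have := Wm q.-1 w i j; rewrite -qE subr_ge0.
  + by move=> i j; have := em q.-1 i j; rewrite -qE.
  rewrite mulrDl lerD//.
  rewrite -!mulnBl !subSnn !mul1n -expnD natrX -/q.
  by have := hm q.-1; rewrite -qE; apply.
Qed.

End maximal.

(** * The variance bound contained in Condition (H2) *)

Section variance.
Context (R : realType) (d : measure_display) (T : measurableType d).
Variable P : probability T R.
Implicit Types (X : nat -> nat -> T -> R) (f : R -> R).

Lemma bounded_integrable (g : T -> R) M : measurable_fun setT g ->
  (forall w, `|g w| <= M) -> P.-integrable setT (EFin \o g).
Proof.
move=> mg gM; apply: measurable_bounded_integrable => //.
  exact: le_lt_trans (probability_le1 _ _) (ltry _).
exists M; split; first exact: num_real.
by move=> y My w _ /=; apply: le_trans (gM w) (ltW My).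
Qed.

Lemma fine_expectationB (g h : T -> R) M N : measurable_fun setT g ->
  measurable_fun setT h -> (forall w, `|g w| <= M) -> (forall w, `|h w| <= N) ->
  fine 'E_P[fun w => g w - h w] = fine 'E_P[g] - fine 'E_P[h].
Proof.
move=> mg mh gM hN.
have ig := bounded_integrable mg gM; have ih := bounded_integrable mh hN.
rewrite unlock; under eq_integral do rewrite EFinB.
by rewrite integralB_EFin// fineB//; exact: integrable_fin_num.
Qed.

Lemma fine_expectationN (h : T -> R) N :
  measurable_fun setT h -> (forall w, `|h w| <= N) ->
  fine 'E_P[fun w => - h w] = - fine 'E_P[h].
Proof.
move=> mh hN; have := @fine_expectationB (cst 0) h 0 N (measurable_cst _) mh.
rewrite expectation_cst/= sub0r => <- //; last by move=> w; rewrite normr0.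
by congr (fine 'E_P[_]); apply/funext => w /=; rewrite sub0r.
Qed.

Definition mean f X i j : R := fine 'E_P[fun w => f (X i j w)].

(** The form in which Condition (H2) is used: one function f for all indices of
    a rectangle.  It is stated for arrays of functions, indexed from 0, so that
    it also makes sense for the array of the opposite variables. *)
Definition rect_variance_bound X (C : R) : Prop :=
  forall f M V x0 x1 y0 y1,
    {homo f : x y / x <= y} -> (forall x, `|f x| <= M) ->
    (forall i j, mean_le P (fun w => f (X i j w) ^+ 2) V) ->
    mean_le P (fun w => rsum (fun i j => f (X i j w) - mean f X i j)
                             x0 x1 y0 y1 ^+ 2)
              (((x1 - x0) * (y1 - y0))%:R * (C * V)).

Lemma uniq_rect_index x0 x1 y0 y1 :
  uniq [seq (i.+1, j.+1) | i <- index_iota x0 x1, j <- index_iota y0 y1].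
Proof.
by rewrite allpairs_uniq ?iota_uniq// => -[? ?] [? ?] _ _ /= [-> ->].
Qed.

Lemma big_rect_fset (A : Type) (idx : A) (op : Monoid.com_law idx)
    (F : nat * nat -> A) k x0 x1 y0 y1 :
  let I := seq_fset k [seq (i.+1, j.+1) | i <- index_iota x0 x1, j <- index_iota y0 y1] in
  \big[op/idx]_(l <- I) F l =
  \big[op/idx]_(x0 <= i < x1) \big[op/idx]_(y0 <= j < y1) F (i.+1, j.+1).
Proof.
move=> I; rewrite /I (perm_big _ (seq_fset_perm _ _))/= undup_id.
  by rewrite big_allpairs_dep.
exact: uniq_rect_index.
Qed.

Lemma condition_H2_variance (X : nat -> nat -> {RV P >-> R}) :
  condition_H2 pos_pairs (fun mn => X mn.1 mn.2) ->
  exists2 C : R, 0 <= C & rect_variance_bound (fun i j => X i.+1 j.+1) C.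
Proof.
case=> C hC; exists (2 * `|C|); first by rewrite mulr_ge0.
move=> f M V x0 x1 y0 y1 fnd fM fV.
have mf : measurable_fun setT f by exact: nondecreasing_measurable.
have mfX i j : measurable_fun setT (fun w => f (X i j w)).
  by apply: measurableT_comp => //; exact: measurable_funPT.
have V0 : 0 <= V by exact: mean_le_ge0 (fV 0%N 0%N).
split.
- apply: measurable_funX.
  apply: (@measurable_rsum _ _ _ (fun i j w => f (X i.+1 j.+1 w))) => i j.
  exact: mfX.
- by move=> w; exact: sqr_ge0.
pose s := [seq (i.+1, j.+1) | i <- index_iota x0 x1, j <- index_iota y0 y1].
pose I := seq_fset tt s.
have memI l : l \in I -> exists i j, l = (i.+1, j.+1).
  rewrite seq_fsetE => /allpairsP[[i j] [_ _ ->]].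
  by exists i, j.
have cI : #|` I|%fset = ((x1 - x0) * (y1 - y0))%N.
  rewrite size_seq_fset undup_id ?size_allpairs ?size_iota//.
  exact: uniq_rect_index.
have M0 : 0 <= M := le_trans (normr_ge0 _) (fM 0).
have := hC I (fun=> f).
have -> : (fun w => (`|\sum_(l <- I) (f (X l.1 l.2 w) -
    fine 'E_P[fun w' => f (X l.1 l.2 w')])| ^+ 2)%R) =
  (fun w => rsum (fun i j => f (X i.+1 j.+1 w) - mean f (fun i j => X i.+1 j.+1) i j)
    x0 x1 y0 y1 ^+ 2).
  apply/funext => w; rewrite real_normK ?num_real//; congr (_ ^+ 2).
  by rewrite big_rect_fset.
move=> H; apply: (le_trans (H _ _ _)).
- by move=> l /memI[i [j ->]].
- by move=> l _.
- move=> l _; split; first exact: (@bounded_integrable _ M).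
  apply: (@bounded_integrable (fun w => f (X l.1 l.2 w) ^+ 2) (M ^+ 2)).
    exact: measurable_funX.
  by move=> w; rewrite normrX ler_pXn2r ?nnegrE.
- rewrite cI.
  have hmax (g : nat * nat -> T -> R) :
     (forall l, l \in I -> g l = (fun w => f (X l.1 l.2 w) ^+ 2)) ->
     (\big[maxe/0]_(l <- I) 'E_P[g l] <= V%:E)%E.
    move=> gE; rewrite big_seq; elim/big_ind: _ => //.
    + by move=> x y xV yV; rewrite ge_max xV yV.
    + move=> l lI; rewrite gE//; have [i [j ->]] := memI l lI.
      by case: (fV i j).
  have le0 z : (z <= V%:E)%E -> (((x1 - x0) * (y1 - y0))%:R%:E * z <=
     (((x1 - x0) * (y1 - y0))%:R * V)%:E)%E.
    by move=> zV; rewrite EFinM lee_wpmul2l// lee_fin.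
  have ge0 g : (0 <= ((x1 - x0) * (y1 - y0))%:R%:E *
      \big[maxe/0]_(l <- I) 'E_P[fun w => (g l w ^+ 2)%R])%E.
    apply: mule_ge0; first by rewrite lee_fin.
    elim/big_ind: _ => //; first by move=> x y x0' _; rewrite le_max x0'.
    by move=> l _; apply: expectation_ge0 => w; exact: sqr_ge0.
  apply: (le_trans (lee_wpmul2r _ (_ : C%:E <= `|C|%:E)%E)).
  + by apply: adde_ge0; exact: ge0.
  + by rewrite lee_fin ler_norm.
  have -> : ((x1 - x0) * (y1 - y0))%:R * (2 * `|C| * V) = 
    `|C| * (((x1 - x0) * (y1 - y0))%:R * V + ((x1 - x0) * (y1 - y0))%:R * V) by ring.
  rewrite EFinM lee_wpmul2l ?lee_fin// EFinD; apply: leeD; apply: le0.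
  + by apply: hmax => l _; apply/funext => w; rewrite real_normK ?num_real.
  + by apply: hmax => l _.
Qed.

(** x |-> - f (- x) is nondecreasing when f is, and a square does not see the
    sign. *)
Lemma rect_variance_boundN X C : (forall i j, measurable_fun setT (X i j)) ->
  rect_variance_bound X C -> rect_variance_bound (fun i j w => - X i j w) C.
Proof.
move=> mX hX f M V x0 x1 y0 y1 fnd fM fV.
have mf : measurable_fun setT f by exact: nondecreasing_measurable.
have := hX (fun x => - f (- x)) M V x0 x1 y0 y1.
have -> : (fun w => rsum (fun i j => - f (- X i j w) -
    mean (fun x => - f (- x)) X i j) x0 x1 y0 y1 ^+ 2) =
  (fun w => rsum (fun i j => f (- X i j w) -
    mean f (fun i j w => - X i j w) i j) x0 x1 y0 y1 ^+ 2).
  apply/funext => w; rewrite -[RHS]sqrrN; congr (_ ^+ 2).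
  rewrite /rsum -sumrN; apply: eq_bigr => i _; rewrite -sumrN; apply: eq_bigr => j _.
  rewrite opprD /mean (@fine_expectationN _ M)// .
  by apply: measurableT_comp => //; exact: measurableT_comp.
apply => [x y xy|x|i j]; first by rewrite lerN2 fnd// lerN2.
  by rewrite normrN.
by under eq_fun do rewrite sqrrN; exact: fV.
Qed.

End variance.

(** * Truncation of the positive part *)

Section clip.
Variable R : realType.
Implicit Types (x y c k : R).

Definition clip c x := Num.min (Num.max x 0) c.

Lemma clip_bound c x : 0 <= c -> 0 <= clip c x <= c.
Proof. by move=> c0; rewrite /clip le_min ge_min le_max !lexx c0 !orbT. Qed.

Lemma clip_nd c : {homo clip c : x y / x <= y}.
Proof.
by move=> x y; rewrite /clip /Order.min /Order.max; do !case: ifPn; rewrite -?leNgt; lra. Qed.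

(** This is what allows the variance bound to be applied to the increments
    between two truncation levels. *)
Lemma clip_incr_nd c c' : 0 <= c -> c <= c' ->
  {homo (fun x => clip c' x - clip c x) : x y / x <= y}.
Proof.
by move=> c0 cc' x y; rewrite /clip /Order.min /Order.max; do !case: ifPn; rewrite -?leNgt; lra. Qed.

Lemma le_clip c c' x : c <= c' -> clip c x <= clip c' x.
Proof. by rewrite /clip /Order.min /Order.max; do !case: ifPn; rewrite -?leNgt; lra. Qed.

Lemma clip_eq c c' x : c <= c' -> `|x| <= c -> clip c' x = clip c x.
Proof.
move=> cc'; rewrite ler_norml => /andP[].
by rewrite /clip /Order.min /Order.max; do !case: ifPn; rewrite -?leNgt; lra.
Qed.

Lemma clipBN c x : `|x| <= c -> clip c x - clip c (- x) = x.
Proof.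
rewrite ler_norml => /andP[].
by rewrite /clip /Order.min /Order.max; do !case: ifPn; rewrite -?leNgt; lra.
Qed.

Lemma measurable_clip c : measurable_fun setT (clip c).
Proof. by apply: nondecreasing_measurable => // x y xy; exact: clip_nd. Qed.

End clip.

(** * The one-sided maximal inequality *)

Section one_sided.
Context (R : realType) (d : measure_display) (T : measurableType d).
Variable P : probability T R.
Implicit Types (X : nat -> nat -> T -> R).

Lemma clip_second_moment (Z : T -> R) (c t : nat -> R) q (K : R) :
  measurable_fun setT Z -> (forall q, 0 <= c q) -> c q <= c q.+1 ->
  (P [set w | (c q < `|Z w|)%R] <= (t q)%:E)%E ->
  mean_le P (fun w => clip (c q) (Z w) ^+ 2) K ->
  mean_le P (fun w => clip (c q.+1) (Z w) ^+ 2) (K + c q.+1 ^+ 2 * t q).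
Proof.
move=> mZ c0 cq Pt hK.
have mA := measurable_tail (c q) mZ.
apply: mean_leS (mean_leD hK (mean_leZ (sqr_ge0 (c q.+1)) (mean_le_indic mA Pt))).
  by apply: measurable_funX; apply: measurableT_comp => //; exact: measurable_clip.
move=> w /=; rewrite sqr_ge0/= indic_bool.
case: ltP => [h|h]; last by rewrite mulr0 addr0 (clip_eq cq h).
have /andP[h1 h2] := clip_bound (Z w) (c0 q.+1).
by rewrite mulr1 ler_wpDl ?sqr_ge0// ler_pXn2r// nnegrE.
Qed.

Lemma clip_incr_mean (Z : T -> R) (c c' t : R) :
  measurable_fun setT Z -> 0 <= c -> c <= c' ->
  (P [set w | (c < `|Z w|)%R] <= t%:E)%E ->
  mean_le P (fun w => clip c' (Z w) - clip c (Z w)) (c' * t).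
Proof.
move=> mZ c0 cc' Pt.
have mA := measurable_tail c mZ.
have c'0 : 0 <= c' by exact: le_trans cc'.
apply: mean_leS (mean_leZ c'0 (mean_le_indic mA Pt)).
  by apply: measurable_funB; apply: measurableT_comp => //; exact: measurable_clip.
move=> w /=; rewrite subr_ge0 le_clip//= indic_bool.
case: ltP => [h|h]; last by rewrite mulr0 (clip_eq cc' h) subrr.
have /andP[h1 h2] := clip_bound (Z w) c0.
have /andP[h3 h4] := clip_bound (Z w) c'0.
by rewrite mulr1; lra.
Qed.

(** The instance of [adaptive_maximal_inequality] for the truncations at levels
    k^q, where k = 2^(1/p).  With r = k^2 / 2 = b^(-4), the second moment of the
    truncation at level q is of order r^q h_q.  Of the four factors b^(N - q)
    that separate 2^N r^q from k^(2N), one pays for replacing h_q by h_N; the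
    other three are those which the maximal inequality asks for.  The inequality
    1 <= k b^2 plays the same part for the means of the increments. *)
Lemma clip_maximal_inequality X (C k b : R) (t h : nat -> R) :
  (forall i j, measurable_fun setT (X i j)) ->
  rect_variance_bound P X C -> 0 <= C ->
  1 <= k -> 0 < b -> b < 1 -> b ^+ 4 * k ^+ 2 = 2 -> 1 <= k * b ^+ 2 ->
  (forall q i j, (P [set w | (k ^+ q < `|X i j w|)%R] <= (t q)%:E)%E) ->
  (forall q, 0 <= t q) -> (forall q, 2 ^+ q * t q <= h q) ->
  1 <= h 0%N -> (forall q, b * h q <= h q.+1) ->
  exists2 K : R, 0 <= K & forall (a : R) m n, 0 < a ->
  exists Bad : set T, [/\ measurable Bad,
    (P Bad <= (K * h (m + n)%N / a ^+ 2)%:E)%E &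
    forall w, ~ Bad w -> forall u v, (u < 2 ^ m)%N -> (v < 2 ^ n)%N ->
      `|rsum (fun i j => clip (k ^+ (m + n)) (X i j w) -
                         mean P (clip (k ^+ (m + n))) X i j) 0 u 0 v|
        <= 3 * (a + 2 * h (m + n)%N / b) * ((1 - b)^-1) ^+ 2 * k ^+ (m + n)].
Proof.
move=> mX hX C0 k1 b0 b1 bk kb hP t0 th h0 hh.
have k0 : 0 < k by exact: lt_le_trans k1.
pose c q : R := k ^+ q.
have c0 q : 0 <= c q by rewrite exprn_ge0// ltW.
have cS q : c q <= c q.+1 by rewrite /c exprS ler_peMl// exprn_ge0// ltW.
have h_ge0 q : 0 <= h q.
  elim: q => [|q IH]; first exact: le_trans h0.
  by apply: le_trans (hh q); rewrite mulr_ge0// ltW.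
pose r : R := k ^+ 2 / 2.
have k2 : k ^+ 2 = 2 * r by rewrite /r; field.
have r0 : 0 < r by rewrite divr_gt0// exprn_gt0.
have br : b ^+ 4 * r = 1 by rewrite /r mulrA bk divff.
have rb1 : 1 < r * b.
  have b3 : b ^+ 3 < 1 by rewrite exprn_ilt1// ltW.
  have : b ^+ 3 * (r * b) = 1 by rewrite -br; ring.
  have rb0 : 0 < r * b by rewrite mulr_gt0.
  move=> e; rewrite -e -subr_gt0.
  have -> : r * b - b ^+ 3 * (r * b) = (1 - b ^+ 3) * (r * b) by ring.
  by rewrite mulr_gt0// subr_gt0.
pose K1 := k ^+ 2 / (r * b - 1).
have rb1' : 0 < r * b - 1 by rewrite subr_gt0.
have K1E : K1 + k ^+ 2 = K1 * (r * b).
  by rewrite /K1; field; rewrite lt0r_neq0.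
have K10 : 0 < K1 by rewrite divr_gt0 ?exprn_gt0.
have K11 : 1 <= K1.
  rewrite ler_pdivlMr// mul1r.
  have : k ^+ 2 * b <= k ^+ 2 by rewrite ler_piMr ?exprn_ge0// ltW.
  have : 0 <= k ^+ 2 * b by rewrite mulr_ge0 ?exprn_ge0// ltW.
  by rewrite /r; lra.
(* Each level adds at most k^(2q+2) t_q <= k^2 r^q h_q, and K1 solves the
   resulting recursion: K1 + k^2 = K1 r b. *)
have mom q i j : mean_le P (fun w => clip (c q) (X i j w) ^+ 2) (K1 * r ^+ q * h q).
  elim: q => [|q IH].
    apply: mean_leS (mean_le_cst P (_ : 0 <= K1 * r ^+ 0 * h 0%N)).
    - by apply: measurable_funX; apply: measurableT_comp => //; exact: measurable_clip.
    - move=> w /=; rewrite sqr_ge0/= expr0 mulr1.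
      have /andP[h1 h2] := clip_bound (X i j w) (c0 0%N).
      apply: (@le_trans _ _ 1); first by rewrite expr_le1.
      by rewrite -[1]mulr1 ler_pM.
    - by rewrite expr0 mulr1 mulr_ge0// ltW.
  apply: mean_leW (clip_second_moment (mX i j) c0 (cS q) (hP q i j) IH).
  have -> : c q.+1 ^+ 2 * t q = k ^+ 2 * r ^+ q * (2 ^+ q * t q).
    by rewrite /c exprAC k2 exprMn !exprS; ring.
  apply: (@le_trans _ _ (K1 * r ^+ q * h q + k ^+ 2 * r ^+ q * h q)).
    by rewrite lerD2l ler_wpM2l// mulr_ge0 ?exprn_ge0// ltW.
  have -> : K1 * r ^+ q * h q + k ^+ 2 * r ^+ q * h q = K1 * r ^+ q.+1 * (b * h q).
    by rewrite -!mulrDl K1E exprS; ring.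
  by rewrite ler_wpM2l// mulr_ge0 ?exprn_ge0// ltW.
have hdecay N q : (q <= N)%N -> h q * b ^+ (N - q) <= h N.
  move=> qN; rewrite -{2}(subnKC qN); elim: (N - q)%N => [|s IH].
    by rewrite addn0 expr0 mulr1.
  rewrite addnS exprS mulrCA; apply: le_trans (hh _).
  by rewrite ler_wpM2l// ltW.
pose g2 : R := ((1 - b)^-1) ^+ 2.
exists (2 * (C * K1) * g2).
  by apply: mulr_ge0; [apply: mulr_ge0 => //; apply: mulr_ge0 => //; exact: ltW|exact: sqr_ge0].
move=> a m n a0.
set N := (m + n)%N.
have kN : 0 < k ^+ N by rewrite exprn_gt0.
have bdclip q x : `|clip (c q) x| <= c q.
  by have /andP[? ?] := clip_bound x (c0 q); rewrite ger0_norm.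
have mclip q i j : measurable_fun setT (fun w => clip (c q) (X i j w)).
  by apply: measurableT_comp => //; exact: measurable_clip.
have eB q i j : mean P (clip (c q.+1)) X i j - mean P (clip (c q)) X i j =
    mean P (fun x => clip (c q.+1) x - clip (c q) x) X i j.
  by rewrite /mean -(@fine_expectationB _ _ _ _ _ _ (c q.+1) (c q)).
have := @adaptive_maximal_inequality _ _ _ P (fun q i j w => clip (c q) (X i j w))
  (fun q i j => mean P (clip (c q)) X i j) (fun q => C * (K1 * r ^+ q * h q))
  (fun q => c q.+1 * t q) b (C * K1 * k ^+ (2 * N) * h N)
  (2 * h N / b * k ^+ N) (a * k ^+ N) m n b0 b1.
rewrite -/N; case.
- by rewrite mulr_gt0.
- by rewrite !mulr_ge0// ?invr_ge0 ltW.
- by rewrite mulr_ge0// mulr_ge0 ?exprn_ge0 ?(ltW k0)// mulr_ge0// ltW.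
- by move=> q w i j; exact: le_clip.
- move=> q i j; rewrite eB.
  have H := clip_incr_mean (mX i j) (c0 q) (cS q) (hP q i j).
  rewrite mean_le_fine// andbT fine_ge0// expectation_ge0// => w.
  by rewrite subr_ge0 le_clip.
- move=> q qN.
  have -> : 2 ^+ q.+1 * (c q.+1 * t q) = 2 * c q.+1 * (2 ^+ q * t q) by rewrite exprS; ring.
  apply: (@le_trans _ _ (2 * c q.+1 * h q)).
    by rewrite ler_wpM2l// mulr_ge0.
  set s := (N - q.+1)%N.
  have sE : (N - q = s.+1)%N by rewrite /s subnSK.
  have NE : (N = q.+1 + s)%N by rewrite /s subnKC.
  have hd : h q * b ^+ s.+1 <= h N by rewrite -sE hdecay// ltnW.
  have -> : 2 * h N / b * k ^+ N * b ^+ s = 2 * c q.+1 * (h N / b * (k ^+ s * b ^+ s)).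
    by rewrite {2}NE exprD /c; ring.
  rewrite ler_wpM2l ?mulr_ge0//.
  apply: (@le_trans _ _ (h q * b ^+ s.+1 / b * (k ^+ s * b ^+ s))); last first.
    rewrite ler_wpM2r ?mulr_ge0 ?exprn_ge0 ?(ltW b0) ?(ltW k0)//.
    by rewrite ler_wpM2r ?invr_ge0 ?(ltW b0).
  have -> : h q * b ^+ s.+1 / b * (k ^+ s * b ^+ s) = h q * (k * b ^+ 2) ^+ s.
    by rewrite exprS exprMn -exprM mulnC exprM; field; rewrite lt0r_neq0.
  by rewrite ler_peMr// exprn_ege1.
- move=> q x0 x1 y0 y1; apply: hX => //; first by move=> x y; exact: clip_nd.
- move=> q x0 x1 y0 y1.
  under eq_fun do under [fun i j => _]eq_fun do under eq_fun do rewrite eB.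
  apply: (hX (fun x => clip (c q.+1) x - clip (c q) x) (c q.+1)).
  + exact: clip_incr_nd.
  + move=> x; have /andP[? ?] := clip_bound x (c0 q).
    have /andP[? ?] := clip_bound x (c0 q.+1); have := le_clip x (cS q).
    by move=> ?; rewrite ger0_norm; lra.
  + move=> i j; apply: mean_leS (mom q.+1 i j).
      by apply: measurable_funX; exact: measurable_funB.
    move=> w; rewrite sqr_ge0/=; have /andP[? ?] := clip_bound (X i j w) (c0 q).
    have := le_clip (X i j w) (cS q) => ?.
    by rewrite ler_pXn2r// ?nnegrE; lra.
- move=> q qN.
  have hd := hdecay N q qN.
  have -> : 2 ^+ N * (C * (K1 * r ^+ q * h q)) = C * K1 * (2 ^+ N * r ^+ q * h q) by ring.
  have -> : C * K1 * k ^+ (2 * N) * h N * b ^+ (3 * (N - q)) =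
    C * K1 * (k ^+ (2 * N) * b ^+ (3 * (N - q)) * h N) by ring.
  apply: ler_wpM2l; first by apply: mulr_ge0 => //; exact: ltW.
  apply: (@le_trans _ _ (k ^+ (2 * N) * b ^+ (3 * (N - q)) * (h q * b ^+ (N - q)))); last first.
    apply: ler_wpM2l => //.
    by apply: mulr_ge0; apply: exprn_ge0; exact: ltW.
  rewrite le_eqVlt; apply/orP; left; apply/eqP.
  set s := (N - q)%N; rewrite -(subnKC qN) -/s.
  have -> : k ^+ (2 * (q + s)) = (2 * r) ^+ (q + s) by rewrite exprM k2.
  have e1 : b ^+ (3 * s) * b ^+ s * r ^+ s = 1.
    by rewrite -exprD -[X in (_ + X)%N]mul1n -mulnDl exprM -exprMn br expr1n.
  rewrite [RHS](_ : _ = 2 ^+ (q + s) * r ^+ q * h q * (b ^+ (3 * s) * b ^+ s * r ^+ s)).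
    by rewrite e1 mulr1.
  by rewrite exprMn [r ^+ (q + s)]exprD; ring.
- move=> Bad [mBad PBad hBad]; exists Bad; split=> //.
  + apply: le_trans PBad _; rewrite lee_fin le_eqVlt; apply/orP; left; apply/eqP.
    rewrite mulnC exprM /g2; have := lt0r_neq0 kN; have := lt0r_neq0 a0.
    move: (k ^+ N) => z a1 z0; have b1' : 1 - b != 0 by rewrite subr_eq0 eq_sym lt_eqF.
    by field; rewrite a1 z0 b1'.
  + move=> w wB u v um vn; apply: le_trans (hBad w wB u v um vn) _.
    rewrite le_eqVlt; apply/orP; left; apply/eqP; ring.
Qed.

End one_sided.

(** * Limits, the slow majorant and the exponents *)

Section limits.
Variable R : realType.

Lemma ge0_ereal_cvg0P (K : Type) (F : set_system K) {FF : Filter F} (f : K -> \bar R) :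
  (forall k, (0 <= f k)%E) ->
  (f k @[k --> F] --> 0%E) <->
  (forall e : R, 0 < e -> \forall k \near F, (f k <= e%:E)%E).
Proof.
move=> f0; split=> [/fine_cvgP[ffin /cvgrPdist_le f_cvg] e e0|H].
  have fe := f_cvg e e0.
  near=> k.
  have fk : f k \is a fin_num by near: k.
  have : `|0 - fine (f k)| <= e by near: k.
  rewrite sub0r normrN ger0_norm ?fine_ge0// => h.
  by rewrite -(fineK fk) lee_fin.
apply/fine_cvgP; split.
  have := H 1 ltr01; apply: filterS => k fk.
  by rewrite ge0_fin_numE// (le_lt_trans fk)// ltry.
apply/cvgrPdist_le => e e0; have := H e e0; apply: filterS => k fk /=.
rewrite sub0r normrN ger0_norm ?fine_ge0// -lee_fin fineK//.
by rewrite ge0_fin_numE// (le_lt_trans fk)// ltry.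
Unshelve. all: by end_near. Qed.

(** h (q+1) = max (b h q, t (q+1)): the maximum of t over the past, discounted
    by b at every step. *)
Lemma slow_majorant (t : nat -> R) (b : R) : 0 < b -> b < 1 ->
  (forall q, 0 <= t q) ->
  (forall e, 0 < e -> \forall q \near \oo, t q <= e) ->
  exists h : nat -> R, [/\ forall q, t q <= h q, 1 <= h 0%N,
    forall q, b * h q <= h q.+1 &
    forall e, 0 < e -> \forall q \near \oo, h q <= e].
Proof.
move=> b0 b1 t0 t_cvg.
pose h := fix h q := if q is q'.+1 then Num.max (b * h q') (t q) else Num.max 1 (t q).
exists h; split.
- by case=> [|q] /=; rewrite le_max lexx orbT.
- by rewrite /= le_max lexx.
- by move=> q /=; rewrite le_max lexx.
move=> e e0.
have [q0 _ hq0] := t_cvg e e0.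
have hs s : h (q0 + s)%N <= Num.max (b ^+ s * h q0) e.
  elim: s => [|s IH]; first by rewrite addn0 expr0 mul1r le_max lexx.
  rewrite addnS /= ge_max; apply/andP; split; last first.
    rewrite le_max; apply/orP; right; apply: hq0 => /=.
    by rewrite -addnS leq_addr.
  apply: (le_trans (ler_wpM2l (ltW b0) IH)).
  rewrite maxr_pMr ?(ltW b0)// mulrA -exprS ge_max le_max lexx/=.
  by rewrite le_max ler_piMl ?orbT// ltW.
have h00 : 0 < h q0 + 1.
  have : 0 <= h q0 by case: (q0) => [|q] /=; rewrite le_max ?ler01// t0 orbT.
  lra.
have bn : `|b| < 1 by rewrite gtr0_norm.
have /cvgrPdist_le /(_ (e / (h q0 + 1)) _) := cvg_expr bn.
case; first by rewrite divr_gt0.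
move=> n _ hn; exists (q0 + n)%N => // q /= qn.
have -> : q = (q0 + (q - q0))%N by rewrite subnKC//; lia.
apply: (le_trans (hs _)); rewrite ge_max lexx andbT.
have := hn (q - q0)%N; rewrite /= sub0r normrN ger0_norm ?exprn_ge0 ?(ltW b0)//.
rewrite ler_pdivlMr// => hb.
apply: (le_trans _ (hb _)); last by lia.
by rewrite ler_wpM2l ?exprn_ge0 ?(ltW b0)// lerDl.
Qed.

(** b = 2^((1 - 2/p)/4) is below 1 exactly because p < 2; the last inequality
    holds since k b^2 = sqrt 2. *)
Lemma exists_ratio (p : R) : 0 < p -> p < 2 ->
  let k := (2 : R) `^ p^-1 in
  1 <= k /\ exists b, [/\ 0 < b, b < 1, b ^+ 4 * k ^+ 2 = 2 & 1 <= k * b ^+ 2].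
Proof.
move=> p0 p2 k.
have h2 : 2^-1 < p^-1 by rewrite ltf_pV2 ?posrE//.
have k1 : 1 <= k by rewrite -[1](powRr0 2); apply: ler_powR; rewrite ?invr_ge0; lra.
split=> //; exists (2 `^ ((1 - 2 * p^-1) / 4)).
have pX n x : (2 `^ x : R) ^+ n = 2 `^ (x * n%:R) by rewrite powRrM powR_mulrn ?powR_ge0.
have pD x y : (2 `^ x : R) * 2 `^ y = 2 `^ (x + y).
  by rewrite powRD//; apply/implyP => _; rewrite pnatr_eq0.
split.
- by rewrite powR_gt0.
- rewrite /powR pnatr_eq0/= expR_lt1 pmulr_llt0; first lra.
  by rewrite ln_gt0// ltr1n.
- rewrite !pX pD -[RHS]powRr1//; congr (_ `^ _); lra.
- rewrite pX pD; apply: (@le_trans _ _ (2 `^ 0)); first by rewrite powRr0.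
  apply: ler_powR; first by lra.
  lra.
Qed.

Lemma trunc_level_exp2 (p : R) q : trunc_level p (2 ^ q) = ((2 : R) `^ p^-1) ^+ q.
Proof.
by rewrite /trunc_level natrX -powR_mulrn// -powRrM mulrC powRrM powR_mulrn//.
Qed.

Lemma trunc_level_le (p : R) m n : 0 < p -> (m <= n)%N -> trunc_level p m <= trunc_level p n.
Proof.
move=> p0 mn; rewrite /trunc_level ge0_ler_powR ?nnegrE ?ler_nat//.
by rewrite invr_ge0 ltW.
Qed.

End limits.

(** * Sufficiency *)

Section max_partial_sums.
Context (R : realType) (d : measure_display) (T : measurableType d).
Variables (P : probability T R).
Implicit Types (p : R) (X : nat -> nat -> {RV P >-> R}).

Lemma rsum_shift (F : nat -> nat -> R) u v :
  \sum_(1 <= i < u.+1) \sum_(1 <= j < v.+1) F i j =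
  rsum (fun i j => F i.+1 j.+1) 0 u 0 v.
Proof. by rewrite big_add1; apply: eq_bigr => i _; rewrite big_add1. Qed.

Lemma measurable_bigmaxr (s : seq nat) (f : nat -> T -> R) :
  (forall i, measurable_fun setT (f i)) ->
  measurable_fun setT (fun w => \big[Num.max/0]_(i <- s) f i w).
Proof.
move=> mf; elim: s => [|i s IH].
  by under eq_fun do rewrite big_nil; exact: measurable_cst.
by under eq_fun do rewrite big_cons; exact: measurable_maxr.
Qed.

Lemma measurable_max_partial_sum p X m n :
  measurable_fun setT (max_partial_sum p X m n).
Proof.
apply: measurable_bigmaxr => u; apply: measurable_bigmaxr => v.
apply: measurableT_comp => //; apply: measurable_sum => i; apply: measurable_sum => j.
by apply: measurable_funB => //; exact: measurable_funPT.
Qed.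

Lemma measurable_weak_law_event p X m n (e : R) :
  measurable [set w | e < `|max_partial_sum p X m n w / (m * n)%:R `^ p^-1 - 0|].
Proof.
apply: (@measurable_tail _ _ _ (fun w => max_partial_sum p X m n w / (m * n)%:R `^ p^-1 - 0)).
apply: measurable_funB => //; apply: measurable_funM => //.
exact: measurable_max_partial_sum.
Qed.

Lemma max_partial_sum_ge0 p X m n w : 0 <= max_partial_sum p X m n w.
Proof.
rewrite /max_partial_sum; elim/big_ind: _ => // [x y x0 _|u _]; first by rewrite le_max x0.
by elim/big_ind: _ => // [x y x0 _]; rewrite le_max x0.
Qed.

Lemma max_partial_sum_le p X m n w (B : R) : 0 <= B ->
  (forall u v, (u <= m)%N -> (v <= n)%N ->
    `|rsum (fun i j => X i.+1 j.+1 w - fine 'E_P[trunc_rv p X (m * n) i.+1 j.+1]) 0 u 0 v| <= B) ->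
  max_partial_sum p X m n w <= B.
Proof.
move=> B0 h; rewrite /max_partial_sum big_nat; apply: bigmax_le => // u /andP[_ um].
rewrite big_nat; apply: bigmax_le => // v /andP[_ vn].
by rewrite rsum_shift; exact: h.
Qed.

(** clip c Z - clip c (- Z) differs from Z cut off at B only when |Z| > B, and
    then by at most c. *)
Lemma centering_error (Z : T -> R) (c' B c t : R) : measurable_fun setT Z ->
  0 <= B -> c' <= B -> B <= c -> (P [set w | (c' < `|Z w|)%R] <= t%:E)%E ->
  `|fine 'E_P[fun w => clip c (Z w)] - fine 'E_P[fun w => clip c (- Z w)]
    - fine 'E_P[fun w => Z w * \1_[set w' | `|Z w'| <= B] w]| <= c * t.
Proof.
move=> mZ B0 c'B Bc Pt.
have c0 : 0 <= c by exact: le_trans Bc.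
pose Z1 w := Z w * \1_[set w' | `|Z w'| <= B] w.
have mA : measurable [set w' | `|Z w'| <= B] by exact: measurable_norm_le.
have mZ1 : measurable_fun setT Z1 by apply: measurable_funM => //; exact: measurable_indic.
have bZ1 w : `|Z1 w| <= B.
  by rewrite /Z1 indic_bool; case: (leP `|Z w| B) => h; rewrite ?mulr1 ?mulr0 ?normr0.
have bc x : `|clip c x| <= c.
  by have /andP[? ?] := clip_bound x c0; rewrite ger0_norm.
have m1 : measurable_fun setT (fun w => clip c (Z w)).
  by apply: measurableT_comp => //; exact: measurable_clip.
have m2 : measurable_fun setT (fun w => clip c (- Z w)).
  by apply: measurableT_comp; [exact: measurable_clip|exact: measurableT_comp].
have m12 := measurable_funB m1 m2.
have b12 w : `|clip c (Z w) - clip c (- Z w)| <= c.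
  have /andP[? ?] := clip_bound (Z w) c0; have /andP[? ?] := clip_bound (- Z w) c0.
  by rewrite ler_norml; apply/andP; split; lra.
rewrite -(@fine_expectationB _ _ _ _ _ _ c c)// -(@fine_expectationB _ _ _ _ _ _ c B)//.
set D := fun w => _.
have mD : measurable_fun setT D by exact: measurable_funB.
have hD : mean_le P (fun w => `|D w|) (c * t).
  have mA' := measurable_tail c' mZ.
  apply: mean_leS (mean_leZ c0 (mean_le_indic mA' Pt)).
    exact: measurableT_comp.
  move=> w /=; rewrite normr_ge0/= indic_bool /D indic_bool.
  case: (leP `|Z w| B) => h.
    by rewrite mulr1 clipBN ?(le_trans h)// subrr normr0 mulr_ge0.
  by rewrite mulr0 subr0 (le_lt_trans c'B h) mulr1.
apply: le_trans (mean_le_fine hD).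
have iD : P.-integrable setT (EFin \o D).
  by apply: (@bounded_integrable _ _ _ _ _ (c + B)) => // w;
    exact: (le_trans (ler_normB _ _) (lerD (b12 w) (bZ1 w))).
have iaD : P.-integrable setT (EFin \o (fun w => `|D w|)).
  apply: (@bounded_integrable _ _ _ _ _ (c + B)); first exact: measurableT_comp.
  by move=> w; rewrite normr_id; exact: (le_trans (ler_normB _ _) (lerD (b12 w) (bZ1 w))).
rewrite unlock -lee_fin -[(`|_|%:E)%E]/(`|(fine _)%:E|)%E !fineK//; try exact: integrable_fin_num.
apply: (le_trans (le_abse_integral _ _ _)) => //.
exact/measurable_EFinP.
Qed.

End max_partial_sums.

Section sufficiency.
Context (R : realType) (d : measure_display) (T : measurableType d).
Variables (P : probability T R).
Implicit Types (p : R) (X : nat -> nat -> {RV P >-> R}).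

Lemma some_tail_event X (c t : R) m n :
  (forall i j, (P [set w | (c < `|X i.+1 j.+1 w|)%R] <= t%:E)%E) -> 
  exists A : set T, [/\ measurable A, (P A <= ((m * n)%:R * t)%:E)%E &
    forall w, ~ A w -> forall i j, (i < m)%N -> (j < n)%N -> `|X i.+1 j.+1 w| <= c].
Proof.
move=> Pt.
pose f i j w : R := \1_[set w | c < `|X i.+1 j.+1 w|] w.
have mX i j : measurable_fun setT (X i j : T -> R) by exact: measurable_funPT.
have hf i j : mean_le P (f i j) t by apply: mean_le_indic => //; exact: measurable_tail.
have := mean_le_sum (index_enum 'I_m) (fun i : 'I_m =>
  mean_le_sum (index_enum 'I_n) (fun j : 'I_n => hf i j)).
rewrite !sumr_const !card_ord -!mulrnA mulnC => hS.
have [mA PA] := mean_le_markov hS.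
eexists; split; [exact: mA|by rewrite mulr_natl; exact: PA|].
move=> w /= /negP; rewrite -ltNge => Sw i j im jn.
have f0 i' j' : 0 <= f i' j' w by rewrite /f indicE.
have : f i j w < 1.
  apply: le_lt_trans Sw.
  apply: (@le_trans _ _ (\sum_(j < n) f i j w)).
    exact: (@term_le_sum _ _ (fun j => f i j w)).
  by apply: (@term_le_sum _ _ (fun i => \sum_(j < n) f i j w)) => // ?; exact: sumr_ge0.
by rewrite /f indic_bool; case: (ltP c `|X i.+1 j.+1 w|) => //= _; rewrite ltxx.
Qed.

Lemma probability_setU3_le (A B C : set T) (a b c : R) :
  measurable A -> measurable B -> measurable C ->
  (P A <= a%:E)%E -> (P B <= b%:E)%E -> (P C <= c%:E)%E ->
  (P (A `|` B `|` C) <= (a + b + c)%:E)%E.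
Proof.
move=> mA mB mC Aa Bb Cc; rewrite !EFinD.
apply: le_trans (measureU2 P (measurableU _ _ mA mB) mC) _.
by apply: leeD => //; apply: le_trans (measureU2 P mA mB) _; exact: leeD.
Qed.

(** The maximal inequality is applied to X and to -X; the sum of X itself is
    the difference of the two as long as no |X(i,j)| exceeds k^N, which fails
    with probability at most 2^N t_N.  The remaining error comes from
    centering at the truncation level (mn)^(1/p) rather than k^N. *)
Lemma weak_law_sufficiency p X (d' : measure_display) (T' : measurableType d')
    (P' : probability T' R) (Y : {RV P' >-> R}) :
  0 < p -> p < 2 ->
  condition_H2 pos_pairs (fun mn => X mn.1 mn.2) ->
  stochastically_dominated pos_pairs (fun mn => X mn.1 mn.2) Y ->
  tail_condition p Y -> weak_law p X.
Proof.
move=> p0 p2 /condition_H2_variance[C C0 hX] dom tail.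
have [k1 [b [b0 b1 bk kb]]] := exists_ratio p0 p2.
set k := 2 `^ p^-1 in k1 bk kb.
have k0 : 0 < k by exact: lt_le_trans k1.
have kX q : 0 < k ^+ q by rewrite exprn_gt0.
pose t q : R := fine (P' [set w | (k ^+ q < `|Y w|)%R]).
have tE q : (P' [set w | (k ^+ q < `|Y w|)%R]) = (t q)%:E.
  by rewrite /t fineK// fin_num_measure//; apply: measurable_tail; exact: measurable_funPT.
have t0 q : 0 <= t q by rewrite fine_ge0.
pose X' i j : T -> R := X i.+1 j.+1.
have mX' i j : measurable_fun setT (X' i j) by exact: measurable_funPT.
have PX q i j : (P [set w | (k ^+ q < `|X' i j w|)%R] <= (t q)%:E)%E.
  rewrite -tE; apply: le_trans (dom (k ^+ q)); apply: ereal_sup_ubound.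
  by exists (i.+1, j.+1).
have tail0 e : 0 < e -> \forall q \near \oo, 2 ^+ q * t q <= e.
  move=> e0.
  have [] := @ge0_ereal_cvg0P R nat \oo _
    (fun n : nat => n%:R%:E * P' [set w | (n%:R `^ p^-1 < `|Y w|)%R])%E.
    by move=> n; rewrite mule_ge0.
  move=> /(_ tail e e0)[n0 _ hn] _; exists n0 => // q /= n0q.
  have := hn (2 ^ q)%N; rewrite /= -/(trunc_level p (2 ^ q)%N) trunc_level_exp2 -/k tE.
  rewrite -EFinM lee_fin natrX; apply.
  by apply: (leq_trans n0q); exact/ltnW/ltn_expl.
have th0 q : 0 <= 2 ^+ q * t q by rewrite mulr_ge0.
have [h [th h0 hh h_cvg]] := slow_majorant b0 b1 th0 tail0.
have [K K0 hK] := clip_maximal_inequality mX' hX C0 k1 b0 b1 bk kb PX t0 th h0 hh.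
have mXN' i j : measurable_fun setT (fun w => - X' i j w) by exact: measurableT_comp.
have PXN q i j : (P [set w | (k ^+ q < `|- X' i j w|)%R] <= (t q)%:E)%E.
  by under eq_set do rewrite normrN; exact: PX.
have [K' K'0 hK'] := clip_maximal_inequality mXN' (rect_variance_boundN mX' hX)
  C0 k1 b0 b1 bk kb PXN t0 th h0 hh.
pose g := ((1 - b)^-1) ^+ 2.
have g0 : 0 < g by rewrite exprn_gt0// invr_gt0 subr_gt0.
have h_ge0 q : 0 <= h q by apply: le_trans (th q).
move=> e e0.
apply/ge0_ereal_cvg0P => // eta eta0.
(* The threshold a is chosen so that the two one-sided sums use up e / 2; the
   terms carrying h N share the other half, through c1. *)
pose a := e / (12 * k ^+ 2 * g).
have a0 : 0 < a by rewrite divr_gt0// mulr_gt0// mulr_gt0.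
pose c1 := k ^+ 2 * (12 / b * g + 4 / b ^+ 2).
have c10 : 0 < c1.
  apply: mulr_gt0; first exact: kX.
  by apply: addr_gt0; [apply: mulr_gt0 => //; exact: divr_gt0|
    apply: divr_gt0 => //; exact: exprn_gt0].
pose c2 := (K + K') / a ^+ 2 + 1.
have c20 : 0 < c2 by rewrite ltr_wpDl// divr_ge0 ?addr_ge0// sqr_ge0.
have [N0 _ hN0] : \forall q \near \oo, h q <= Num.min (e / 2 / c1) (eta / c2).
  by apply: h_cvg; rewrite lt_min !divr_gt0.
exists (2 ^ N0)%N => -[m n] [/= m0 n0] mn.
pose lm := trunc_log 2 m; pose ln := trunc_log 2 n.
have /andP[lm1 lm2] := trunc_log_bounds (isT : (1 < 2)%N) m0.
have /andP[ln1 ln2] := trunc_log_bounds (isT : (1 < 2)%N) n0.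
rewrite -/lm -/ln in lm1 lm2 ln1 ln2.
set N := (lm.+1 + ln.+1)%N.
have NN : (N0 <= N)%N.
  move: mn; rewrite leq_max => /orP[] h'.
    have : (2 ^ N0 < 2 ^ lm.+1)%N by exact: leq_ltn_trans h' lm2.
    by rewrite ltn_exp2l// => /ltnW/leq_trans; apply; rewrite leq_addr.
  have : (2 ^ N0 < 2 ^ ln.+1)%N by exact: leq_ltn_trans h' ln2.
  by rewrite ltn_exp2l// => /ltnW/leq_trans; apply; rewrite leq_addl.
have := hN0 N NN; rewrite le_min => /andP[hNe hNeta].
have mnlt : (m * n < 2 ^ N)%N by rewrite /N expnD ltn_mul.
have mnge : (2 ^ (lm + ln) <= m * n)%N by rewrite expnD leq_mul.
have NE : N = (lm + ln).+2 by rewrite /N addSn addnS.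
set B := trunc_level p (m * n).
have Bge : k ^+ (lm + ln) <= B by rewrite -trunc_level_exp2 trunc_level_le.
have Ble : B <= k ^+ N by rewrite -trunc_level_exp2 trunc_level_le// ltnW.
have B0 : 0 < B by exact: lt_le_trans Bge.
(* N exceeds the logarithm of mn by at most 2, hence the factor k^2. *)
have kNB : k ^+ N <= k ^+ 2 * B by rewrite NE -addn2 exprD mulrC ler_wpM2l// ltW.
have [A1 [mA1 PA1 hA1]] := hK a lm.+1 ln.+1 a0.
have [A2 [mA2 PA2 hA2]] := hK' a lm.+1 ln.+1 a0.
have [A3 [mA3 PA3 hA3]] := some_tail_event m n (PX N).
rewrite -/N in PA1 hA1 PA2 hA2.
have PU := probability_setU3_le mA1 mA2 mA3 PA1 PA2 PA3.
apply: (@le_trans _ _ (P (A1 `|` A2 `|` A3))); last first.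
  apply: (le_trans PU); rewrite lee_fin.
  have : (m * n)%:R * t N <= h N.
    apply: le_trans (th N); apply: ler_wpM2r => //.
    by rewrite -natrX ler_nat ltnW.
  have : c2 * h N <= eta by rewrite mulrC -ler_pdivlMr.
  rewrite /c2; lra.
apply: le_measure.
- by rewrite inE; exact: measurable_weak_law_event.
- by rewrite inE; apply: measurableU => //; exact: measurableU.
move=> w /=; apply: contraPP => /not_orP[/not_orP[wA1 wA2] wA3].
apply/negP; rewrite -leNgt subr0.
rewrite -/(trunc_level p (m * n)) -/B ger0_norm; last first.
  by rewrite divr_ge0 ?max_partial_sum_ge0// ltW.
rewrite ler_pdivrMr//.
pose S := 3 * (a + 2 * h N / b) * g * k ^+ N.
have S0 : 0 <= S.
  rewrite mulr_ge0// ?(ltW (kX _))// mulr_ge0// ?(ltW g0)// mulr_ge0//.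
  by rewrite addr_ge0 ?(ltW a0)// divr_ge0 ?(ltW b0)// mulr_ge0.
have hN2 : h (lm + ln)%N <= h N / b ^+ 2.
  rewrite ler_pdivlMr ?exprn_gt0// NE mulrC expr2 -mulrA.
  by apply: le_trans (hh _); rewrite ler_wpM2l// ltW.
have SB : S + S + 4 * (h N / b ^+ 2) * k ^+ N <= e * B.
  have -> : S + S + 4 * (h N / b ^+ 2) * k ^+ N =
    (6 * a * g + (12 / b * g + 4 / b ^+ 2) * h N) * k ^+ N by rewrite /S; ring.
  apply: (@le_trans _ _ ((6 * a * g + (12 / b * g + 4 / b ^+ 2) * h N) * (k ^+ 2 * B))).
    apply: ler_wpM2l => //; apply: addr_ge0.
      by apply: mulr_ge0; [apply: mulr_ge0 => //|]; exact: ltW.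
    apply: mulr_ge0 => //; apply: addr_ge0; last by rewrite divr_ge0// sqr_ge0.
    by apply: mulr_ge0; [apply: divr_ge0 => //|]; exact: ltW.
  rewrite mulrA ler_wpM2r ?(ltW B0)//.
  have -> : (6 * a * g + (12 / b * g + 4 / b ^+ 2) * h N) * k ^+ 2 =
    6 * a * g * k ^+ 2 + c1 * h N by rewrite /c1; ring.
  have -> : 6 * a * g * k ^+ 2 = e / 2.
    by rewrite /a; field; rewrite ?lt0r_neq0.
  have : c1 * h N <= e / 2 by rewrite mulrC -ler_pdivlMr.
  lra.
apply: max_partial_sum_le => [|u v um vn]; first by rewrite mulr_ge0// ltW.
apply: le_trans SB.
have u2 : (u < 2 ^ lm.+1)%N by exact: leq_ltn_trans lm2.
have v2 : (v < 2 ^ ln.+1)%N by exact: leq_ltn_trans ln2.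
pose c := clip (k ^+ N).
pose F1 i j := c (X' i j w) - mean P c X' i j.
pose F2 i j := c (- X' i j w) - mean P c (fun i j w => - X' i j w) i j.
pose F3 i j := mean P c X' i j - mean P c (fun i j w => - X' i j w) i j
  - fine 'E_P[trunc_rv p X (m * n) i.+1 j.+1].
have -> : rsum (fun i j => X i.+1 j.+1 w - fine 'E_P[trunc_rv p X (m * n) i.+1 j.+1]) 0 u 0 v
  = rsum F1 0 u 0 v - rsum F2 0 u 0 v + rsum F3 0 u 0 v.
  rewrite -rsumB /rsum -big_split/=; apply: eq_big_nat => i /andP[_ iu].
  rewrite -big_split/=; apply: eq_big_nat => j /andP[_ jv].
  rewrite -{1}(@clipBN _ (k ^+ N) (X i.+1 j.+1 w)).
    by rewrite /F1 /F2 /F3 /c /X'; ring.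
  by apply: hA3 => //; [exact: leq_trans um|exact: leq_trans vn].
apply: (le_trans (ler_normD _ _)); apply: lerD.
  by apply: (le_trans (ler_normB _ _)); apply: lerD; [exact: hA1|exact: hA2].
have F3le i j : `|F3 i j| <= k ^+ N * t (lm + ln)%N.
  exact: (centering_error (mX' i j) (ltW B0) Bge Ble (PX _ i j)).
apply: (@le_trans _ _ (rsum (fun _ _ => k ^+ N * t (lm + ln)%N) 0 u 0 v)).
  apply: (le_trans (ler_norm_sum _ _ _)); apply: ler_sum => i _.
  by apply: (le_trans (ler_norm_sum _ _ _)); apply: ler_sum => j _.
rewrite rsum_cst !subn0.
apply: (@le_trans _ _ (2 ^+ N * (k ^+ N * t (lm + ln)%N))).
  apply: ler_wpM2r; first by rewrite mulr_ge0// ltW.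
  by rewrite -natrX ler_nat /N expnD leq_mul// ltnW.
rewrite NE.
have -> : 2 ^+ (lm + ln).+2 * (k ^+ (lm + ln).+2 * t (lm + ln)%N) =
  4 * (2 ^+ (lm + ln) * t (lm + ln)%N) * k ^+ (lm + ln).+2 by rewrite ![2 ^+ _.+1]exprS; ring.
rewrite -NE; apply: ler_wpM2r; first exact: ltW.
by rewrite ler_wpM2l// (le_trans (th _)).
Qed.

End sufficiency.

(** * Necessity *)

Section necessity.
Context (R : realType) (d : measure_display) (T : measurableType d).
Variables (P : probability T R).
Implicit Types (p : R) (X : nat -> nat -> {RV P >-> R}).

Lemma symmetric_odd_mean0 (Z : {RV P >-> R}) (f : R -> R) (M : R) :
  symmetric_rv Z -> measurable_fun setT f -> (forall x, `|f x| <= M) ->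
  (forall x, f (- x) = - f x) -> fine 'E_P[fun w => f (Z w)] = 0.
Proof.
move=> sZ mf fM fN.
have mZ : measurable_fun setT (Z : T -> R) by exact: measurable_funPT.
pose NZ : {mfun T >-> R} := - (Z : {mfun T >-> R}).
have mNZ : measurable_fun setT (NZ : T -> R) by exact: measurable_funPT.
have fZ : fine 'E_P[fun w => f (NZ w)] = - fine 'E_P[fun w => f (Z w)].
  rewrite -(@fine_expectationN _ _ _ _ _ M)//; last exact: measurableT_comp.
  by congr (fine 'E_P[_]); apply/funext => w; rewrite -fN.
have : fine 'E_P[fun w => f (NZ w)] = fine 'E_P[fun w => f (Z w)].
  have int (U : {mfun T >-> R}) : P.-integrable setT ((EFin \o f) \o U).
    apply: (@bounded_integrable _ _ _ _ (f \o U) M) => [|w]; last exact: fM.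
    by apply: measurableT_comp => //; exact: measurable_funPT.
  rewrite unlock; congr fine.
  transitivity (\int[P]_w ((EFin \o f) \o NZ) w)%E; first by [].
  rewrite -integral_distribution//; last exact/measurable_EFinP.
  transitivity (\int[P]_w ((EFin \o f) \o Z) w)%E; last by [].
  rewrite -integral_distribution//; last exact/measurable_EFinP.
  by apply: eq_measure_integral => A mA _; rewrite /distribution/pushforward; apply/esym/sZ.
rewrite fZ; lra.
Qed.

Lemma max_partial_sum_ge p X m n w u v : (0 < u <= m)%N -> (0 < v <= n)%N ->
  `|rsum (fun i j => X i.+1 j.+1 w - fine 'E_P[trunc_rv p X (m * n) i.+1 j.+1]) 0 u 0 v|
  <= max_partial_sum p X m n w.
Proof.
move=> um vn; rewrite -(rsum_shift (fun i j => X i j w - fine 'E_P[trunc_rv p X (m * n) i j])).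
rewrite /max_partial_sum.
apply: (@le_trans _ _ (\big[Num.max/0]_(1 <= v < n.+1) `|\sum_(1 <= i < u.+1)
   \sum_(1 <= j < v.+1) (X i j w - fine 'E_P[trunc_rv p X (m * n) i j])|)).
  apply: (le_bigmax_seq _ v) => //; first by rewrite mem_index_iota ltnS.
apply: (le_bigmax_seq 0 u xpredT (fun u => \big[Num.max/0]_(1 <= v < n.+1) `|\sum_(1 <= i < u.+1)
   \sum_(1 <= j < v.+1) (X i j w - fine 'E_P[trunc_rv p X (m * n) i j])|)) => //.
by rewrite mem_index_iota ltnS.
Qed.

(** Let S be the number of exceedances among n variables and mu its mean; its
    variance is at most C mu, and S vanishes off E.  Then, for every tau > 0,
    2 S <= (S - mu)^2 / tau + (2 mu + tau) 1_E pointwise, and taking means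
    gives 2 mu <= C mu / tau + (2 mu + tau) P(E); with tau = 4 C + 1 and
    P(E) <= 1/4 the terms in mu on the right are absorbed. *)
Lemma exceedance_count_le (Z : nat -> nat -> T -> R) (C B q e : R) n (E : set T) :
  (forall i j, measurable_fun setT (Z i j)) ->
  rect_variance_bound P Z C -> 0 <= C ->
  (forall i j, (P [set w | (B < Z i j w)%R] = q%:E)%E) ->
  measurable E -> (P E <= e%:E)%E -> e <= 4^-1 ->
  (forall w i, (i < n)%N -> B < Z i 0%N w -> E w) ->
  n%:R * q <= (4 * C + 1) * e.
Proof.
move=> mZ hZ C0 Pq mE PE e4 hE.
pose f x : R := (B < x)%R%:R.
have f_nd : {homo f : x y / x <= y}.
  move=> x y xy; rewrite /f ler_nat; case: (ltP B x) => // Bx.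
  by rewrite (lt_le_trans Bx xy).
have f01 x : 0 <= f x <= 1 by rewrite /f; case: ltP; rewrite ?lexx ?ler01.
have mA i j : measurable [set w | B < Z i j w] by exact: measurable_gt.
have fE i j : (fun w => f (Z i j w)) = \1_[set w | B < Z i j w].
  by apply/funext => w; rewrite /f indic_bool.
have Ef i j : ('E_P[fun w => f (Z i j w)] = q%:E)%E by rewrite fE expectation_indic.
have q0 : 0 <= q by rewrite -lee_fin -(Pq 0%N 0%N).
have f2 i j : mean_le P (fun w => f (Z i j w) ^+ 2) q.
  have -> : (fun w => f (Z i j w) ^+ 2) = \1_[set w | B < Z i j w].
    by rewrite -fE; apply/funext => w; rewrite /f; case: ltP; rewrite ?expr1n ?expr0n.
  by apply: mean_le_indic; rewrite ?Pq.
have f_le1 x : `|f x| <= 1 by have /andP[? ?] := f01 x; rewrite ger0_norm.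
have := hZ f 1 q 0%N n 0%N 1%N f_nd f_le1 f2.
rewrite !subn0 muln1.
set mu := n%:R * q.
pose S w := \sum_(0 <= i < n) f (Z i 0%N w).
have -> : (fun w => rsum (fun i j => f (Z i j w) - mean P f Z i j) 0 n 0 1 ^+ 2) =
    (fun w => (S w - mu) ^+ 2).
  apply/funext => w; congr (_ ^+ 2); rewrite rsumB; congr (_ - _).
    by apply: eq_bigr => i _; rewrite big_nat1.
  rewrite /mean; under [X in rsum X]eq_fun do under eq_fun do rewrite Ef.
  by rewrite rsum_cst !subn0 muln1.
have -> : n%:R * (C * q) = C * mu by rewrite /mu; ring.
move=> hS.
have mu0 : 0 <= mu by rewrite mulr_ge0.
have S0 w : 0 <= S w by apply: sumr_ge0 => i _; case/andP: (f01 (Z i 0%N w)).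
pose tau := 4 * C + 1.
have tau0 : 0 < tau by rewrite ltr_wpDl// mulr_ge0.
have hE1 := mean_le_indic mE PE.
have tau' : 0 <= tau^-1 by rewrite invr_ge0 ltW.
have mt0 : 0 <= 2 * mu + tau by rewrite addr_ge0 ?mulr_ge0// ltW.
have [_ _ ub] : mean_le P (fun w => 2 * S w) (tau^-1 * (C * mu) + (2 * mu + tau) * e).
  apply: mean_leS (mean_leD (mean_leZ tau' hS) (mean_leZ mt0 hE1)).
    apply: measurable_funM => //; apply: measurable_sum => i.
    by rewrite fE; exact: measurable_indic.
  move=> w /=; rewrite mulr_ge0//= indicE.
  have [wE|wE] := boolP (w \in E); last first.
    have -> : S w = 0.
      rewrite /S big_nat big1// => i /andP[_ i_n].
      rewrite /f; case: (ltP B (Z i 0%N w)) => // /(hE w i i_n) wE'.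
      by move: wE => /negP[]; rewrite inE.
    by rewrite !mulr0 addr0; apply: mulr_ge0 => //; exact: sqr_ge0.
  rewrite mulr1.
  have -> : tau^-1 * (S w - mu) ^+ 2 + (2 * mu + tau) =
     2 * S w + tau^-1 * (S w - mu - tau) ^+ 2 by field; rewrite lt0r_neq0.
  by rewrite lerDl mulr_ge0// sqr_ge0.
have lb : ('E_P[fun w => (2 * S w)%R] = (2 * mu)%:E)%E.
  rewrite unlock; under eq_integral do rewrite EFinM.
  rewrite ge0_integralZl_EFin//; last 2 first.
    by move=> w _; rewrite lee_fin.
    by apply/measurable_EFinP; apply: measurable_sum => i; rewrite fE; exact: measurable_indic.
  rewrite EFinM; congr (_ * _)%E.
  under eq_integral do rewrite -sumEFin.
  rewrite ge0_integral_sum//.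
  - rewrite (eq_bigr (fun=> q%:E)) => [|i _]; last by rewrite -(Ef i 0%N) unlock.
    by rewrite sumEFin sumr_const_nat subn0 /mu mulr_natl.
  - by move=> i; apply/measurable_EFinP; rewrite fE; exact: measurable_indic.
  - by move=> i w _; rewrite lee_fin; case/andP: (f01 (Z i 0%N w)).
move: ub; rewrite lb lee_fin -/tau.
have : tau^-1 * (C * mu) <= mu / 4.
  rewrite mulrC ler_pdivrMr// /tau; have : 0 <= mu * C by rewrite mulr_ge0.
  by lra.
have : mu * e <= mu * 4^-1 by rewrite ler_wpM2l.
by lra.
Qed.

(** Only the n x 1 arrays are used: X(i,1) is the difference of two consecutive
    partial sums, so it cannot exceed b unless one of them exceeds b / 2 in
    absolute value. *)
Lemma weak_law_necessity p X (d' : measure_display) (T' : measurableType d')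
    (P' : probability T' R) (Y : {RV P' >-> R}) :
  0 < p -> condition_H2 pos_pairs (fun mn => X mn.1 mn.2) ->
  (forall m n : nat, (0 < m)%N -> (0 < n)%N ->
     symmetric_rv (X m n) /\ same_distribution (X m n) Y) ->
  weak_law p X -> tail_condition p Y.
Proof.
move=> p0 /condition_H2_variance[C C0 hX] hsym wl.
pose X' i j : T -> R := X i.+1 j.+1.
have mX' i j : measurable_fun setT (X' i j) by exact: measurable_funPT.
have mray (B : R) : measurable [set x : R | B < x].
  by rewrite -set_itvoy; exact: measurable_itv.
have mray' (B : R) : measurable [set x : R | B < `|x|].
  exact: (@measurable_tail _ _ _ (fun x : R => x)).
apply/ge0_ereal_cvg0P => [n|e e0]; first by rewrite mule_ge0.
have quarter : 0 < 4^-1 :> R by [].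
pose e1 := Num.min 4^-1 (e / (2 * (4 * C + 1))).
have t0 : 0 < 2 * (4 * C + 1) by rewrite mulr_gt0// ltr_wpDl// mulr_ge0.
have e10 : 0 < e1 by rewrite lt_min quarter divr_gt0.
have [N0 hN0] : \forall mn \near maxn_pinfty,
  (P [set w | (4^-1 < `|max_partial_sum p X mn.1 mn.2 w / (mn.1 * mn.2)%:R `^ p^-1 - 0|)%R]
    <= e1%:E)%E.
  have /ge0_ereal_cvg0P := wl _ quarter.
  by apply.
exists (maxn N0 1) => // n /=; rewrite geq_max => /andP[N0n n1].
have := hN0 (n, 1%N) (conj n1 (ltn0Sn 0)).
rewrite /= leq_max N0n => /(_ isT).
set E := [set w | _] => PE.
set B := trunc_level p n.
rewrite -/(trunc_level p n) -/B.
have B0 : 0 < B by rewrite powR_gt0// ltr0n.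
pose q := fine (P [set w | B < X' 0%N 0%N w]).
have Pq i j : P [set w | B < X' i j w] = q%:E.
  rewrite /q fineK; last by rewrite fin_num_measure//; exact: measurable_gt.
  have [_ sd] := hsym i.+1 j.+1 isT isT; have [_ sd0] := hsym 1%N 1%N isT isT.
  by have := sd _ (mray B); rewrite -(sd0 _ (mray B)).
have PY : (P' [set w | (B < `|Y w|)%R] <= (2 * q)%:E)%E.
  have [sy sd] := hsym 1%N 1%N isT isT.
  have := sd _ (mray' B); rewrite /distribution /pushforward /preimage /= => <-.
  have -> : [set w | B < `|X 1%N 1%N w|] =
      [set w | B < X' 0%N 0%N w] `|` [set w | B < - X' 0%N 0%N w].
    by apply/seteqP; split=> w /=; rewrite lter_normr => /orP.
  have mA : measurable [set w | B < X' 0%N 0%N w].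
    exact: measurable_gt.
  have mA' : measurable [set w | B < - X' 0%N 0%N w].
    by apply: measurable_gt; exact: measurableT_comp.
  apply: (le_trans (measureU2 P mA mA')).
  have symB : P [set w | B < - X' 0%N 0%N w] = q%:E.
    by rewrite -(Pq 0%N 0%N); exact/esym/(sy _ (mray B)).
  have le1 : (P [set w | (B < X' 0%N 0%N w)%R] <= q%:E)%E by rewrite Pq.
  have le2 : (P [set w | (B < - X' 0%N 0%N w)%R] <= q%:E)%E by rewrite symB.
  by rewrite mulr_natl mulr2n EFinD; exact: leeD.
have cent i j : fine 'E_P[trunc_rv p X n i.+1 j.+1] = 0.
  have [sy _] := hsym i.+1 j.+1 isT isT.
  pose f x : R := x * \1_[set x : R | `|x| <= B] x.
  apply: (@symmetric_odd_mean0 _ f B sy).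
  - apply: measurable_funM => //; apply: measurable_indic.
    exact: (@measurable_norm_le _ _ _ (fun x : R => x)).
  - move=> x; rewrite /f indic_bool; case: (leP `|x| B) => h; rewrite ?mulr1 ?mulr0 ?normr0//.
    exact: ltW.
  - by move=> x; rewrite /f !indic_bool normrN mulNr.
have hE w i : (i < n)%N -> B < X' i 0%N w -> E w.
  move=> i_n Bx; rewrite /E /= subr0 muln1 -/(trunc_level p n) -/B.
  have M0 := max_partial_sum_ge0 p X n 1 w.
  rewrite ger0_norm ?divr_ge0 ?(ltW B0)// ltr_pdivlMr//.
  have rs u : rsum (fun i j => X i.+1 j.+1 w -
      fine 'E_P[trunc_rv p X (n * 1) i.+1 j.+1]) 0 u 0 1 = \sum_(0 <= i < u) X' i 0%N w.
    by apply: eq_bigr => k _; rewrite big_nat1 muln1 cent subr0.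
  have hi : `|\sum_(0 <= i < i.+1) X' i 0%N w| <= max_partial_sum p X n 1 w.
    by rewrite -rs; apply: max_partial_sum_ge.
  have hi' : `|\sum_(0 <= i < i) X' i 0%N w| <= max_partial_sum p X n 1 w.
    case: i i_n {Bx hi} => [|i] i_n; first by rewrite big_geq// normr0.
    by rewrite -rs; apply: max_partial_sum_ge => //=; exact: ltnW.
  move: hi hi'; rewrite big_nat_recr//= !ler_norml => /andP[_ h1] /andP[h2 _].
  move: h1 h2; move: (\sum_(_ <= _ < _) _) (max_partial_sum _ _ _ _ _) M0 => s M; lra.
have mE : measurable E by exact: measurable_weak_law_event.
have e14 : e1 <= 4^-1 by rewrite ge_min lexx.
have cnt := exceedance_count_le mX' hX C0 Pq mE PE e14 hE.
apply: (@le_trans _ _ (n%:R%:E * (2 * q)%:E)%E); first by rewrite lee_wpmul2l// lee_fin.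
rewrite -EFinM lee_fin.
have : 2 * (4 * C + 1) * e1 <= e by rewrite mulrC -ler_pdivlMr// ge_min lexx orbT.
by lra.
Qed.

End necessity.

Theorem theorem1p5 (R : realType) (d : measure_display) (T : measurableType d)
    (P : probability T R) (p : R) (X : nat -> nat -> {RV P >-> R}) :
  1 <= p -> p < 2 ->
  condition_H2 pos_pairs (fun mn => X mn.1 mn.2) ->
  (forall (d' : measure_display) (T' : measurableType d')
      (P' : probability T' R) (Y : {RV P' >-> R}),
    stochastically_dominated pos_pairs (fun mn => X mn.1 mn.2) Y ->
    tail_condition p Y ->
    weak_law p X) /\
  (forall (d' : measure_display) (T' : measurableType d')
      (P' : probability T' R) (Y : {RV P' >-> R}),
    (forall m n : nat, (0 < m)%N -> (0 < n)%N ->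
       symmetric_rv (X m n) /\ same_distribution (X m n) Y) ->
    weak_law p X ->
    tail_condition p Y).
Proof.
move=> p1 p2 H2; have p0 : 0 < p by exact: lt_le_trans p1.
split=> d' T' P' Y; first exact: weak_law_sufficiency.
exact: weak_law_necessity.
Qed.
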